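(* Let $d\ge 4$ be an integer and let $W\subset \mathbb{P}^3$ be a very general surface of degree $d$. Then there are no curves $X,Y\subset \mathbb{P}^3$ such that $W =X\star Y$.
   Context: $\mathbb{P}^3$ is the complex projective space with a fixed system of homogeneous coordinates $x_0,x_1,x_2,x_3$. The degree $d$ surfaces of $\mathbb{P}^3$ are parametrized by the projective space $|\mathcal{O}_{\mathbb{P}^3}(d)|$ of dimension $\binom{d+3}{3}-1$. ''Very general'' means outside countably many proper Zariski closed subsets of $|\mathcal{O}_{\mathbb{P}^3}(d)|$; i.e. the assertion is that, for each $d\ge 4$, there is a countable union of proper Zariski closed subsets of $|\mathcal{O}_{\mathbb{P}^3}(d)|$ such that the conclusion holds for all $W$ outside it. Hadamard product of points: for $P=[p_0:\dots :p_3]$ and $Q=[q_0:\dots :q_3]$ with $p_iq_i\ne 0$ for at least one $i$, $P\star Q:=[p_0q_0:\dots :p_3q_3]$; if $p_iq_i=0$ for all $i$, $P\star Q$ is not defined. Hadamard product of varieties: the product is defined for irreducible (closed) subvarieties $X,Y\subset\mathbb{P}^3$ such that $P\star Q$ is well-defined for at least one $(P,Q)\in X\times Y$ (so curves are irreducible here); $P\star Q$ is then well-defined for $(P,Q)$ in a non-empty Zariski open subset of $X\times Y$, and $X\star Y$ is the Zariski closure in $\mathbb{P}^3$ of the set of all well-defined products $P\star Q$ with $P\in X$, $Q\in Y$. *)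

(* Defs.v *)
From HB Require Import structures.
From mathcomp Require Import all_boot all_order all_algebra.
From mathcomp Require Import boolp classical_sets reals topology_structure.
From mathcomp Require Import mpoly complex.

Set Implicit Arguments.
Unset Strict Implicit.
Unset Printing Implicit Defensive.

Import GRing.Theory.
Local Open Scope ring_scope.
Local Open Scope classical_set_scope.

(* The projective space P(V) of lines through the origin of a vector space V. *)
Definition projspace (K : fieldType) (V : vectType K) : Type :=
  {L : {vspace V} | \dim L == 1%N}.

HB.instance Definition _ (K : fieldType) (V : vectType K) :=
  Choice.on (projspace V).

(* v is a vector of homogeneous coordinates of P; this forces v != 0. *)
Definition represents (K : fieldType) (V : vectType K)
    (v : V) (P : projspace V) : Prop :=
  <[v]>%VS = val P.

(* Homogeneous polynomial functions on V. Linear changes of coordinates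
   preserve homogeneity, so the choice of the basis is immaterial; see
   homog_funE and projspace_closedE below. *)
Definition homog_fun (K : fieldType) (V : vectType K) (g : V -> K) : Prop :=
  exists k (f : {mpoly K[\dim {:V}]}), f \is k.-homog /\
    forall v, g v = f.@[fun i => coord (vbasis {:V}) i v].

Definition zeros (K : fieldType) (V : vectType K) (S : set (V -> K)) :
    set (projspace V) :=
  [set P | forall g, S g -> forall v, represents v P -> g v = 0].

Definition zariski_closed (K : fieldType) (V : vectType K)
    (A : set (projspace V)) : Prop :=
  exists2 S : set (V -> K), (forall g, S g -> homog_fun g) & A = zeros S.

Section ZariskiTopology.
Context (K : fieldType) (V : vectType K).
Implicit Types (g h : V -> K) (P : projspace V) (A B : set (projspace V)).

Lemma represents_ex P : exists v, represents v P.
Proof.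
case: P => L dL; have /eqP dL1 := dL.
have vL : vpick L \in L by exact: memv_pick.
exists (vpick L); apply/eqP; rewrite /= eqEdim -memvE vL dL1 dim_vline.
by rewrite vpick0 -dimv_eq0 dL1.
Qed.

Lemma represents_neq0 v P : represents v P -> v != 0.
Proof.
case: P => L dL; rewrite /represents /= => e; apply/eqP => v0.
by move: dL; rewrite -e v0 dim_vline eqxx.
Qed.

Lemma represents_scale v w P :
  represents v P -> represents w P -> exists2 c, c != 0 & w = c *: v.
Proof.
move=> rv rw; have /vlineP [c e] : w \in <[v]>%VS by rewrite rv -rw memv_line.
exists c => //; apply: contraNneq (represents_neq0 rw) => c0.
by rewrite e c0 scale0r.
Qed.

Lemma mevalZ_homog n k (f : {mpoly K[n]}) (x : 'I_n -> K) c :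
  f \is k.-homog -> f.@[fun i => c * x i] = c ^+ k * f.@[x].
Proof.
move=> /dhomogP hf; rewrite !mevalE mulr_sumr !big_seq; apply: eq_bigr => m /hf.
rewrite /= mdegE => <-.
rewrite [RHS]mulrCA; congr (_ * _).
by rewrite -prodrXr -big_split; apply: eq_bigr => i _; rewrite exprMn.
Qed.

Lemma homog_fun_eq0 g v w P :
  homog_fun g -> represents v P -> represents w P -> g v = 0 -> g w = 0.
Proof.
move=> [k [f [hf gE]]] rv rw gv0; have [c _ ->] := represents_scale rv rw.
rewrite gE (_ : (fun i => _) = fun i => c * coord (vbasis {:V}) i v).
  by rewrite (mevalZ_homog _ _ hf) -gE gv0 mulr0.
by apply: funext => i; rewrite linearZ.
Qed.

Lemma homog_fun1 : homog_fun (fun _ : V => 1).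
Proof. by exists 0%N, 1; split=> [|v]; rewrite ?dhomog1 ?meval1. Qed.

Lemma homog_funM g h :
  homog_fun g -> homog_fun h -> homog_fun (fun v => g v * h v).
Proof.
move=> [k [f [hf gE]]] [k' [f' [hf' hE]]]; exists (k + k')%N, (f * f').
by split=> [|v]; [exact: dhomogM | rewrite mevalM gE hE].
Qed.

Lemma homog_subst n m k (f : {mpoly K[n]}) (M : 'I_n -> 'I_m -> K) :
  f \is k.-homog -> exists2 f' : {mpoly K[m]}, f' \is k.-homog &
    forall x, f'.@[x] = f.@[fun i => \sum_j M i j * x j].
Proof.
move=> hf; pose lq := [tuple (\sum_j M i j *: 'X_j : {mpoly K[m]}) | i < n].
have hlq i : tnth lq i \is 1.-homog.
  rewrite tnth_mktuple rpred_sum // => j _; rewrite rpredZ //.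
  by rewrite dhomogX /= mdeg1.
exists (f \mPo lq) => [|x].
  rewrite comp_mpolyEX big_seq rpred_sum // => a /(dhomog_mf hf) <-.
  rewrite rpredZ // comp_mpolyX /= mdegE.
  elim/big_rec2: _ => [|i d q _ hq]; first exact: dhomog1.
  by apply: dhomogM => //; have := dhomogMn (a i) (hlq i); rewrite mul1n.
rewrite comp_mpoly_meval; congr meval; apply: funext => i.
rewrite tnth_mktuple raddf_sum /=; apply: eq_bigr => j _.
by rewrite mevalZ mevalXU.
Qed.

Lemma homog_funE n (e : n.-tuple V) g : basis_of {:V} e ->
  homog_fun g <-> exists k (f : {mpoly K[n]}), f \is k.-homog /\
    forall v, g v = f.@[fun i => coord e i v].
Proof.
have coordE m p (b : m.-tuple V) (c : p.-tuple V) i v : basis_of {:V} c ->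
    coord b i v = \sum_(j < p) coord b i c`_j * coord c j v.
  move=> bc; rewrite {1}(coord_basis bc (memvf v)) raddf_sum /=.
  by apply: eq_bigr => j _; rewrite linearZ mulrC.
move=> be; split=> -[k [f [hf gE]]].
  have [f' hf' f'E] :=
    homog_subst (fun i (j : 'I_n) => coord (vbasis {:V}) i e`_j) hf.
  exists k, f'; split=> // v; rewrite gE f'E; congr meval; apply: funext => i.
  exact: coordE.
have [f' hf' f'E] :=
  homog_subst (fun i (j : 'I_(\dim {:V})) => coord e i (vbasis {:V})`_j) hf.
exists k, f'; split=> // v; rewrite gE f'E; congr meval; apply: funext => i.
exact: coordE (vbasisP _).
Qed.

Lemma zariski_closed0 : @zariski_closed K V set0.
Proof.
exists [set fun _ => 1] => [g ->|]; first exact: homog_fun1.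
apply/esym; rewrite -subset0 => P /(_ _ erefl); have [v rv] := represents_ex P.
by move=> /(_ v rv) /eqP; rewrite oner_eq0.
Qed.

Lemma zariski_closedU A B :
  zariski_closed A -> zariski_closed B -> zariski_closed (A `|` B).
Proof.
move=> [S hS ->] [T hT ->].
exists [set gh | exists2 g, S g & exists2 h, T h & gh = fun v => g v * h v].
  by move=> _ [g Sg [h Th ->]]; apply: homog_funM; [exact: hS | exact: hT].
apply/seteqP; split => [P [SP|TP] _ [g Sg [h Th ->]] v rv|P STP].
- by rewrite (SP g Sg v rv) mul0r.
- by rewrite (TP h Th v rv) mulr0.
have [v rv] := represents_ex P.
have [SP|/existsNP [g /not_implyP [Sg gv]]] := pselect (forall g, S g -> g v = 0).
  by left=> g Sg w rw; apply: (homog_fun_eq0 (hS _ Sg) rv rw); exact: SP.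
right=> h Th w rw; apply: (homog_fun_eq0 (hT _ Th) rv rw).
have /eqP := STP _ (ex_intro2 _ _ g Sg (ex_intro2 _ _ h Th erefl)) v rv.
by rewrite mulf_eq0 => /orP [/eqP//|/eqP].
Qed.

Lemma zariski_closed_bigI J (F : J -> set (projspace V)) :
  (forall i, zariski_closed (F i)) -> zariski_closed (\bigcap_i F i).
Proof.
move=> clF; exists [set g | exists i, homog_fun g /\ F i `<=` zeros [set g]].
  by move=> g [i []].
apply/seteqP; split => [P FP g [i [_ Fg]] v rv|P FP i _].
  exact: (Fg P (FP i I) g erefl v rv).
have [S hS FE] := clF i; rewrite FE => g Sg v rv; apply: FP rv; exists i.
by split=> [|Q]; [exact: hS | rewrite FE => SQ _ -> w rw; exact: (SQ g Sg w rw)].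
Qed.

Let opT : zariski_closed (~` [set: projspace V]).
Proof. by rewrite setCT; exact: zariski_closed0. Qed.

Let opI : setI_closed [set A : set (projspace V) | zariski_closed (~` A)].
Proof. by move=> A B /= cA cB; rewrite setCI; exact: zariski_closedU. Qed.

Let op_bigU I (F : I -> set (projspace V)) :
  (forall i, zariski_closed (~` F i)) -> zariski_closed (~` \bigcup_i F i).
Proof. by move=> cF; rewrite setC_bigcup; exact: zariski_closed_bigI. Qed.

HB.instance Definition _ :=
  isOpenTopological.Build (projspace V) opT opI op_bigU.

Lemma closed_zariski A : closed A <-> zariski_closed A.
Proof.
split=> [cA|cA]; last by rewrite -[A]setCK; apply: open_closedC; rewrite /open /= setCK.
by have := closed_openC cA; rewrite /open /= setCK.
Qed.

End ZariskiTopology.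

Lemma projspace_closedE (K : fieldType) n (A : set (projspace 'rV[K]_n)) :
  closed A <-> exists2 S : set {mpoly K[n]},
    (forall f, S f -> exists k, f \is k.-homog) &
    A = [set P | forall f, S f ->
                 forall v : 'rV[K]_n, represents v P -> f.@[v 0] = 0].
Proof.
have toE (v : 'rV[K]_n) j : coord (vbasis fullv) j v =
    \sum_i coord (vbasis fullv) j (delta_mx 0 i : 'rV[K]_n) * v 0 i.
  rewrite {1}[v]row_sum_delta raddf_sum /=; apply: eq_bigr => i _.
  by rewrite linearZ mulrC.
have ofE (v : 'rV[K]_n) i :
    v 0 i = \sum_(j < \dim {:'rV[K]_n}) ((vbasis fullv)`_j : 'rV[K]_n) 0 i *
      coord (vbasis fullv) j v.
  rewrite {1}(coord_basis (vbasisP _) (memvf v)) summxE.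
  by apply: eq_bigr => j _; rewrite mxE mulrC.
rewrite closed_zariski; split=> -[S hS ->].
  exists [set f | (exists k, f \is k.-homog) /\ S (fun v => f.@[v 0])].
    by move=> f [].
  apply/seteqP; split=> [P SP f [_ Sf] v|P SP g Sg v rv]; first exact: (SP _ Sf).
  have [k [f [hf gE]]] := hS g Sg.
  have [f' hf' f'E] := homog_subst
    (fun i (j : 'I_n) => coord (vbasis fullv) i (delta_mx 0 j : 'rV[K]_n)) hf.
  have fE : g = fun v => f'.@[v 0].
    apply: funext => w; rewrite gE f'E; congr meval; apply: funext => i.
    exact: toE.
  rewrite fE; apply: (SP f') rv; split; first by exists k.
  by rewrite -fE.
exists [set g | exists2 f, S f & g = fun v : 'rV[K]_n => f.@[v 0]].
  move=> _ [f Sf ->]; have [k hf] := hS f Sf.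
  have [f' hf' f'E] := homog_subst (fun i (j : 'I_(\dim {:'rV[K]_n})) =>
    ((vbasis fullv)`_j : 'rV[K]_n) 0 i) hf.
  exists k, f'; split=> // v; rewrite f'E; congr meval; apply: funext => i.
  exact: ofE.
apply/seteqP; split=> [P SP _ [f Sf ->] v rv|P SP f Sf v rv]; first exact: (SP f Sf).
exact: (SP _ (ex_intro2 _ _ f Sf erefl) v rv).
Qed.

Section Dimension.
Context {T : topologicalType}.
Implicit Types X : set T.

Definition irreducible X : Prop :=
  X !=set0 /\ forall F G : set T, closed F -> closed G ->
    X `<=` F `|` G -> X `<=` F \/ X `<=` G.

(* A chain Z 0 < Z 1 < ... < Z m of irreducible closed subsets of X
   (for X closed, closed in X and closed in T are the same). *)
Definition has_chain X (m : nat) : Prop :=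
  exists Z : nat -> set T,
    (forall i, (i <= m)%N -> [/\ closed (Z i), irreducible (Z i) & Z i `<=` X])
    /\ (forall i, (i < m)%N -> Z i `<` Z i.+1).

Definition has_dim X (m : nat) : Prop := has_chain X m /\ ~ has_chain X m.+1.

Definition curve X : Prop := [/\ closed X, irreducible X & has_dim X 1].

Definition very_general (Q : T -> Prop) : Prop :=
  exists B : nat -> set T,
    (forall k, closed (B k) /\ B k <> setT) /\
    (forall w, ~ (\bigcup_k B k) w -> Q w).

End Dimension.

Definition P3 (K : fieldType) := projspace 'rV[K]_4.

(* |O_{P^3}(d)|: dhomog 4 K d is the space of forms of degree d in x_0, ..., x_3,
   of dimension 'C(d + 3, d). *)
Definition linsys (K : fieldType) (d : nat) := projspace (dhomog 4 K d).

(* The closed points of the surface of equation w; multiplicities of components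
   are forgotten, which only matters for non-reduced (hence special) w. *)
Definition surface (K : fieldType) (d : nat) (w : linsys K d) : set (P3 K) :=
  [set P | forall F : dhomog 4 K d, represents F w ->
           forall v : 'rV[K]_4, represents v P -> (F : {mpoly K[4]}).@[v 0] = 0].

Section Hadamard.
Context (K : fieldType).
Implicit Types (P Q R : P3 K) (X Y : set (P3 K)).

(* P * Q is well-defined and equal to R; the coordinatewise product represents
   no point when it is zero. *)
Definition hadamard_point P Q R : Prop :=
  exists p q : 'rV[K]_4,
    [/\ represents p P, represents q Q & represents (map2_mx *%R p q) R].

Definition hadamard_points X Y : set (P3 K) :=
  [set R | exists P Q, [/\ X P, Y Q & hadamard_point P Q R]].

Definition hadamard_defined X Y : Prop := hadamard_points X Y !=set0.

Definition hadamard X Y : set (P3 K) := closure (hadamard_points X Y).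

End Hadamard.

(* Main.v *)
From HB Require Import structures.
Require Import Defs.
From mathcomp Require Import all_boot all_order all_algebra.
From mathcomp Require Import perm zify.
From mathcomp Require Import boolp classical_sets functions reals topology_structure.
From mathcomp Require Import polyXY separable mpoly complex.

(** A generic form F cannot vanish on a product X * Y for the following reason.
    Write W for the surface F = 0, W_i for its section by the coordinate plane
    x_i = 0, and X_i, Y_i for the sections of the curves; coordinatewise
    multiplication by a point P is a linear map.  Assume first that on
    points of X_i only the i-th coordinate vanishes, and on points of Y_j only the
    j-th, for some i and j; this holds if neither curve meets an edge of the coordinate
    tetrahedron.  For P in X_i the curve P * Y lies in W_i, it is closed because the
    projection of Y from the i-th vertex is, and W_i is irreducible; so P * Y = W_i.
    Intersecting with x_j = 0 gives P * Y_j = W_ij, where W_ij is the finite set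
    of points of W on the edge x_i = x_j = 0; symmetrically X_i * Q = W_ij for
    every Q in Y_j.  Now W_ij has at least two points, so there are Q and Q'
    in Y_j with Q / Q' nontrivial on the edge, and then W_ij is invariant under
    the scaling Q / Q'.  For a generic F the d ratios x_k / x_l on W_ij are
    distinct with nonzero sum, and such a set has no nontrivial scaling
    symmetry.  This is no_transversal_pair; its key step is fiber_onto.

    In the other positions one of the curves, say X, has a point on an edge
    x_i = x_j = 0.  Multiplying Y by this point lands in the finite set W_ij,
    hence Y lies in a plane x_k = c x_l (hadamard_pair_edge); then Y has a
    point with x_k = x_l = 0 and X lies in a plane x_i = c' x_j.  Away from the
    cases where W itself is contained in a plane, this makes the planes x_k = 0
    for X and x_i = 0 for Y transversal in the sense above
    (hadamard_pair_no_edge), and the first argument applies.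

    The only property of curves used is that they are irreducible, closed and
    not single points.  In particular they meet every coordinate plane
    (hcurve_meets_plane).  This fact, the closedness of P * Y, and the closedness
    of the set of reducible forms all come from one statement, the main theorem of
    elimination theory (elim_closed), proved by eliminating one variable at a
    time with resultants (proj_closed).  That an irreducible closed subset of
    W_i which is not a point is all of W_i is the weak form of Bezout in
    resultant_eq0_dvd: if two polynomials in k[x][y], the first of which has
    a constant leading coefficient and no proper factor, have zero resultant,
    then the first divides the second.

    Finally each genericity condition holds outside a proper closed set of forms:
    the bad set is algebraic, by elimination, and one explicit form avoids it.
    The forms are x_i^d (no vertex on W), x_k^(d-1) x_l (nonzero sum of ratios),
    x_k^d + x_l^d (distinct ratios) and x_j^d + x_k x_l^(d-1) (irreducible
    section). *)

Set Implicit Arguments.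
Unset Strict Implicit.
Unset Printing Implicit Defensive.

Import GRing.Theory.
Local Open Scope ring_scope.
Local Open Scope classical_set_scope.

(** * Polynomial functions and algebraic sets *)

(** The polynomial functions on a set T with coordinates c: the algebra of
    functions generated by c.  Keeping T and c arbitrary lets the same notion serve
    for affine spaces, products of them, and spaces of forms. *)
Inductive pfun (K : comNzRingType) (T : Type) (c : set (T -> K)) : (T -> K) -> Prop :=
| pf_const a : pfun c (fun=> a)
| pf_gen g : c g -> pfun c g
| pf_add g h : pfun c g -> pfun c h -> pfun c (fun x => g x + h x)
| pf_mul g h : pfun c g -> pfun c h -> pfun c (fun x => g x * h x).

Section Pfun.
Context (K : comNzRingType).

Lemma pf_comp (T U : Type) (c : set (T -> K)) (c' : set (U -> K)) (phi : U -> T) g :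
  (forall h, c h -> pfun c' (fun u => h (phi u))) ->
  pfun c g -> pfun c' (fun u => g (phi u)).
Proof.
move=> cc'; elim=> [a|h /cc'//|g1 g2 _ h1 _ h2|g1 g2 _ h1 _ h2].
- exact: pf_const.
- exact: pf_add.
- exact: pf_mul.
Qed.

Context (T : Type) (c : set (T -> K)).

Lemma pf_opp g : pfun c g -> pfun c (fun x => - g x).
Proof.
move=> pg; have -> : (fun x => - g x) = (fun x => -1 * g x).
  by apply/funext => x; rewrite mulN1r.
by apply: pf_mul => //; exact: pf_const.
Qed.

Lemma pf_sub g h : pfun c g -> pfun c h -> pfun c (fun x => g x - h x).
Proof. by move=> pg ph; apply: pf_add => //; exact: pf_opp. Qed.

Lemma pf_sum I (r : seq I) (P : pred I) (F : I -> T -> K) :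
  (forall i, P i -> pfun c (F i)) -> pfun c (fun x => \sum_(i <- r | P i) F i x).
Proof.
move=> pF; rewrite -(fct_sumE r P F); elim/big_ind: _ => [|g h|i /pF//].
  exact: (pf_const c 0).
exact: pf_add.
Qed.

Lemma pf_prod I (r : seq I) (P : pred I) (F : I -> T -> K) :
  (forall i, P i -> pfun c (F i)) -> pfun c (fun x => \prod_(i <- r | P i) F i x).
Proof.
move=> pF; rewrite -(fct_prodE r P F); elim/big_ind: _ => [|g h|i /pF//].
  exact: (pf_const c 1).
exact: pf_mul.
Qed.

Lemma pf_exp g n : pfun c g -> pfun c (fun x => g x ^+ n).
Proof.
move=> pg; elim: n => [|n ih]; first exact: pf_const.
have -> : (fun x => g x ^+ n.+1) = (fun x => g x * g x ^+ n).
  by apply/funext => x; rewrite exprS.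
exact: pf_mul.
Qed.

Lemma pf_meval n (p : {mpoly K[n]}) (g : 'I_n -> T -> K) :
  (forall i, pfun c (g i)) -> pfun c (fun x => p.@[fun i => g i x]).
Proof.
move=> pg; have -> : (fun x => p.@[fun i => g i x]) =
  (fun x => \sum_(m <- msupp p) p@_m * \prod_i g i x ^+ m i).
  by apply/funext => x; rewrite mevalE.
apply: pf_sum => m _; apply: pf_mul; first exact: pf_const.
by apply: pf_prod => i _; exact: pf_exp.
Qed.

End Pfun.

(** The coordinate functions of an affine space, of a product, and of the line. *)
Definition coord_fun (K I : Type) : set ((I -> K) -> K) :=
  [set g | exists i, g = fun x => x i].
Definition prod_fun (K T U : Type) (c : set (T -> K)) (e : set (U -> K)) :
    set (T * U -> K) :=
  [set g | (exists2 h, c h & g = fun z => h z.1) \/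
           (exists2 h, e h & g = fun z => h z.2)].
Definition line_fun (K : Type) : set (K -> K) := [set id].

Section Alg.
Context (K : fieldType).

(** A set is algebraic when every point outside it is separated from it by a
    polynomial function vanishing on the set. *)
Definition alg (T : Type) (c : set (T -> K)) (Z : set T) : Prop :=
  forall x, ~ Z x -> exists2 u, pfun c u & u x != 0 /\ forall z, Z z -> u z = 0.

Context (T : Type) (c : set (T -> K)).
Implicit Types Z : set T.

Lemma pf_fst U (e : set (U -> K)) g : pfun c g -> pfun (prod_fun c e) (fun z => g z.1).
Proof. by apply: pf_comp => h ch; apply: pf_gen; left; exists h. Qed.

Lemma pf_snd U (e : set (U -> K)) g : pfun c g -> pfun (prod_fun e c) (fun z => g z.2).
Proof. by apply: pf_comp => h ch; apply: pf_gen; right; exists h. Qed.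

Lemma alg0 : alg c set0.
Proof. by move=> x _; exists (fun=> 1); [exact: pf_const|rewrite oner_eq0]. Qed.

Lemma algU Z Z' : alg c Z -> alg c Z' -> alg c (Z `|` Z').
Proof.
move=> aZ aZ' x /not_orP[/aZ [u pu [ux uZ]] /aZ' [v pv [vx vZ']]].
exists (fun x => u x * v x); first exact: pf_mul.
split; first by rewrite mulf_neq0.
by move=> z [/uZ ->|/vZ' ->]; rewrite ?mul0r ?mulr0.
Qed.

Lemma alg_bigI I (Z : I -> set T) : (forall i, alg c (Z i)) ->
  alg c [set x | forall i, Z i x].
Proof.
move=> aZ x /existsNP[i /aZ[u pu [ux uZ]]]; exists u => //; split=> // z Zz.
exact: uZ.
Qed.

Lemma algI Z Z' : alg c Z -> alg c Z' -> alg c (Z `&` Z').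
Proof.
move=> aZ aZ' x /not_andP[/aZ|/aZ'] [u pu [ux uZ]]; exists u => //; split=> // z [].
  by move=> /uZ.
by move=> _ /uZ.
Qed.

Lemma alg_zero g : pfun c g -> alg c [set x | g x = 0].
Proof. by move=> pg x /eqP gx; exists g. Qed.

Lemma alg_eq g h : pfun c g -> pfun c h -> alg c [set x | g x = h x].
Proof.
move=> pg ph x /eqP gx; exists (fun x => g x - h x); first exact: pf_sub.
by split; [rewrite subr_eq0|move=> z /= ->; rewrite subrr].
Qed.

Lemma alg_preim U (e : set (U -> K)) (phi : U -> T) Z :
  (forall h, c h -> pfun e (fun u => h (phi u))) -> alg c Z ->
  alg e [set u | Z (phi u)].
Proof.
move=> ce aZ x /aZ [u pu [ux uZ]]; exists (fun x => u (phi x)).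
  exact: pf_comp pu.
by split=> // z /uZ.
Qed.

(** The Zariski closure. *)
Definition zclosure Z : set T :=
  [set x | forall u, pfun c u -> (forall z, Z z -> u z = 0) -> u x = 0].

Lemma sub_zclosure Z : Z `<=` zclosure Z.
Proof. by move=> x Zx u _; apply. Qed.

Lemma alg_zclosure Z : alg c (zclosure Z).
Proof.
move=> x /existsNP[u /not_implyP[pu /not_implyP[uZ /eqP ux]]].
by exists u => //; split=> // z; apply.
Qed.

End Alg.

(** The functions on T as a ring; the point v0 only witnesses that T is inhabited,
    so that the ring is not trivial. *)
Definition fring (T : Type) (v0 : T) (K : Type) : Type := T -> K.

Section FunctionRing.
Context (T : Type) (v0 : T) (K : comNzRingType).
HB.instance Definition _ := GRing.ComPzRing.on (fring v0 K).

Let fring1_neq0 : (1 : fring v0 K) != 0.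
Proof. by apply/eqP => /(congr1 (@^~ v0)) /eqP; rewrite oner_eq0. Qed.
HB.instance Definition _ := GRing.PzSemiRing_isNonZero.Build (fring v0 K) fring1_neq0.
HB.instance Definition _ := GRing.ComPzRing.on (fring v0 K).

(** Evaluation at v. *)
Definition fev (v : T) (f : fring v0 K) : K := f v.

Lemma fev_is_zmod v : zmod_morphism (fev v). Proof. by []. Qed.
Lemma fev_is_monoid v : monoid_morphism (fev v). Proof. by []. Qed.
HB.instance Definition _ v := GRing.isZmodMorphism.Build (fring v0 K) K (fev v) (fev_is_zmod v).
HB.instance Definition _ v := GRing.isMonoidMorphism.Build (fring v0 K) K (fev v) (fev_is_monoid v).

End FunctionRing.

(** * Projection along a line *)

Section Resultants.
Context (R S : comNzRingType) (f : {rmorphism R -> S}).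
Implicit Types p q : {poly R}.

Lemma resultant_map p q : f (lead_coef p) != 0 -> f (lead_coef q) != 0 ->
  f (resultant p q) = resultant (map_poly f p) (map_poly f q).
Proof.
move=> fp fq; rewrite /resultant /Sylvester_mx !size_map_poly_id0 // -det_map_mx.
rewrite map_col_mx; congr (\det (col_mx _ _));
  by apply: map_lin1_mx => v; rewrite map_poly_rV rmorphM /= map_rVpoly.
Qed.

Lemma resultant_root p q s : (1 < size p)%N -> (1 < size q)%N ->
  (map_poly f p).[s] = 0 -> (map_poly f q).[s] = 0 -> f (resultant p q) = 0.
Proof.
move=> sp sq ps qs; have [[u v] _ /(congr1 (fun r => (map_poly f r).[s]))] :=
  resultant_in_ideal sp sq.
by rewrite map_polyC hornerC /= => ->; rewrite rmorphD !rmorphM hornerD !hornerM ps qs !mulr0 addr0.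
Qed.

End Resultants.

Section Projection.
Context (K : closedFieldType) (T : Type) (c : set (T -> K)).

Lemma pf_det v0 n (M : 'M[fring v0 K]_n) : (forall i j, pfun c (M i j)) ->
  pfun c (\det M).
Proof.
move=> pM; have -> : (\det M : T -> K) = (fun v =>
    \sum_(s : 'S_n) (-1) ^+ (odd_perm s) * \prod_i M i (s i) v).
  apply/funext => v; have := rmorph_sum (@fev T v0 K v).
  rewrite -[LHS]/(fev v (\det M)) -det_map_mx => _; apply: eq_bigr => s _.
  by congr (_ * _); apply: eq_bigr => i _; rewrite mxE.
apply: pf_sum => s _; apply: pf_mul; first exact: pf_const.
by apply: pf_prod => i _; exact: pM.
Qed.

Lemma pf_resultant v0 (p q : {poly fring v0 K}) :
  (forall i, pfun c p`_i) -> (forall i, pfun c q`_i) -> pfun c (resultant p q).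
Proof.
move=> pp pq; apply: pf_det => i j; rewrite Sylvester_mxE.
case: (fintype.split i) => r; case: leqP => _; rewrite ?mulr1n ?mulr0n //; exact: (pf_const c 0).
Qed.

Lemma pf_line_poly v0 (g : K * T -> K) : pfun (prod_fun (@line_fun K) c) g ->
  exists2 p : {poly fring v0 K}, (forall i, pfun c p`_i) &
    forall z, g z = (map_poly (fev z.2) p).[z.1].
Proof.
pose cst a : fring v0 K := fun=> a.
elim=> [a|h|g1 g2 _ [p1 h1 E1] _ [p2 h2 E2]|g1 g2 _ [p1 h1 E1] _ [p2 h2 E2]].
- exists (cst a)%:P => [i|z]; last by rewrite map_polyC hornerC.
  by rewrite coefC; case: eqP => _; [exact: (pf_const c a)|exact: (pf_const c 0)].
- case=> [[_ -> ->]|[h' ch ->]].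
    exists 'X => [i|z]; last by rewrite map_polyX hornerX.
    by rewrite coefX; case: eqP => _; [exact: (pf_const c 1)|exact: (pf_const c 0)].
  exists (h' : fring v0 K)%:P => [i|z]; last by rewrite map_polyC hornerC.
  by rewrite coefC; case: eqP => _; [exact: pf_gen|exact: (pf_const c 0)].
- exists (p1 + p2) => [i|z]; first by rewrite coefD; exact: pf_add (h1 i) (h2 i).
  by rewrite rmorphD hornerD E1 E2.
- exists (p1 * p2) => [i|z]; last by rewrite rmorphM hornerM E1 E2.
  have -> : ((p1 * p2)`_i : T -> K) = fun v => \sum_(j < i.+1) (p1`_j v * p2`_(i - j) v).
    by apply/funext => v; rewrite coefM -[LHS]/(fev v _) rmorph_sum.
  by apply: pf_sum => j _; apply: pf_mul.
Qed.

(** One polynomial function can separate Z from finitely many points of a line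
    at once. *)
Lemma separate_seq (Z : set (K * T)) v0 (L : seq K) :
  alg (prod_fun (@line_fun K) c) Z -> (forall r, r \in L -> ~ Z (r, v0)) ->
  exists2 g, pfun (prod_fun (@line_fun K) c) g &
    (forall z, Z z -> g z = 0) /\ forall r, r \in L -> g (r, v0) != 0.
Proof.
move=> aZ; elim: L => [|s L ih] LZ.
  by exists (fun=> 0); [exact: pf_const|].
have [r rL|g pg [gZ gL]] := ih; first by apply: LZ; rewrite in_cons rL orbT.
have [gs|gs] := eqVneq (g (s, v0)) 0; last first.
  by exists g => //; split=> // r; rewrite in_cons => /predU1P[->|/gL].
have [sL|sL] := boolP (s \in L); first by have := gL s sL; rewrite gs eqxx.
have [h ph [hs hZ]] := aZ _ (LZ s (mem_head _ _)).
exists (fun z => g z + h z * \prod_(r <- L) (z.1 - r)).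
  apply: pf_add => //; apply: pf_mul => //; apply: pf_prod => r _.
  apply: pf_sub; last exact: pf_const.
  exact: (pf_fst c (pf_gen (erefl : @line_fun K id))).
split=> [z Zz|r]; first by rewrite gZ // hZ // mul0r addr0.
rewrite in_cons => /predU1P[->|rL] /=.
  rewrite gs add0r mulf_neq0 // prodf_seq_neq0; apply/allP => r' rL /=.
  by rewrite subr_eq0; apply: contraNneq sL => ->.
by rewrite (big_rem r) //= subrr mul0r mulr0 addr0 gL.
Qed.

(** Closedness of the projection of Z from the line, near v0: if Z satisfies an
    equation q with leading coefficient nonzero at v0 and has no point above v0, then a
    resultant of q with another equation of Z separates v0 from the projection. *)
Lemma proj_closed (Z : set (K * T)) v0 (q : {poly fring v0 K}) :
  alg (prod_fun (@line_fun K) c) Z ->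
  (forall i, pfun c q`_i) -> fev v0 (lead_coef q) != 0 -> (1 < size q)%N ->
  (forall z, Z z -> (map_poly (fev z.2) q).[z.1] = 0) ->
  (forall s, ~ Z (s, v0)) ->
  exists2 u, pfun c u & u v0 != 0 /\ forall z, Z z -> u z.2 = 0.
Proof.
move=> aZ pq lq sq qZ Zv0; set q0 := map_poly (fev v0) q.
have qn0 : q != 0 by rewrite -size_poly_gt0 (ltn_trans _ sq).
have q0n0 : q0 != 0 by rewrite map_poly_eq0_id0.
have [L q0E] := closed_field_poly_normal q0.
have [g pg [gZ gL]] := separate_seq aZ (fun r (_ : r \in L) => Zv0 r).
have [p pp gE] := pf_line_poly v0 pg.
(* adding a multiple of q gives the second polynomial the leading coefficient of q,
   nonzero at v0, so that the resultant commutes with evaluation at v0 *)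
pose p' := p + q * 'X^(size p).
have sp' : size p' = size (q * 'X^(size p)).
  by rewrite /p' addrC size_polyDl // size_mulXn // -addn1 leq_add2l (ltnW sq).
have lp' : lead_coef p' = lead_coef q.
  rewrite /p' addrC lead_coefDl ?lead_coef_Mmonic ?monicXn //.
  by rewrite size_mulXn // -addn1 leq_add2l (ltnW sq).
have pp' i : pfun c p'`_i.
  rewrite /p' coefD coefMXn; apply: (pf_add (pp i)).
  by case: ifP => _; [exact: (pf_const c 0)|exact: pq].
exists (resultant q p'); first exact: pf_resultant.
split=> [|z Zz].
  change (fev v0 (resultant q p') != 0); rewrite resultant_map ?lp' // resultant_eq0 -leqNgt.
  rewrite -/q0; set p0 := map_poly _ p'.
  have cop : coprimep q0 p0.
    rewrite q0E coprimepZl ?lead_coef_eq0 // coprimep_sym.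
    rewrite (big_nth 0) big_mkord; elim/big_ind: _ => [|a b|i _].
    - exact: coprimep1.
    - by rewrite coprimepMr => -> ->.
    rewrite coprimep_XsubC; set r := L`_i.
    have rL : r \in L by exact: mem_nth.
    apply/negP => /rootP; rewrite /p0 /p' rmorphD rmorphM hornerD hornerM -/q0.
    have -> : q0.[r] = 0.
      by rewrite q0E hornerZ; apply/eqP; rewrite mulf_eq0 -rootE root_prod_XsubC rL orbT.
    rewrite mul0r addr0 => p0r; have := gL r rL; by rewrite gE /= p0r eqxx.
  by move: cop; rewrite /coprimep => /eqP ->.
change (fev z.2 (resultant q p') = 0); apply: (@resultant_root _ _ _ _ _ z.1) => //.
- by rewrite sp' size_mulXn // (leq_trans sq) // leq_addl.
- exact: qZ.
by rewrite /p' rmorphD rmorphM hornerD hornerM qZ // mul0r addr0 -gE gZ.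
Qed.

End Projection.

(** * Elimination of homogeneous variables *)

Section Elimination.
Context (K : closedFieldType) (T : Type) (c : set (T -> K)).

(** The vector x with s prepended. *)
Definition fcons n (s : K) (x : 'I_n -> K) (i : 'I_n.+1) : K :=
  if unlift ord0 i is Some j then x j else s.

Lemma fcons0 n s (x : 'I_n -> K) : fcons s x ord0 = s.
Proof. by rewrite /fcons unlift_none. Qed.

Lemma fconsS n s (x : 'I_n -> K) i : fcons s x (lift ord0 i) = x i.
Proof. by rewrite /fcons liftK. Qed.

Lemma fconsE n (x : 'I_n.+1 -> K) : x = fcons (x ord0) (fun i => x (lift ord0 i)).
Proof.
by apply/funext => i; case: (unliftP ord0 i) => [j|] ->; rewrite ?fcons0 ?fconsS.
Qed.

Lemma fconsZ n a s (x : 'I_n -> K) :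
  (fun i => a * fcons s x i) = fcons (a * s) (fun i => a * x i).
Proof.
by apply/funext => i; case: (unliftP ord0 i) => [j|] ->; rewrite ?fcons0 ?fconsS.
Qed.

(** Stable under scaling of the first argument. *)
Definition conical n (Z : set (('I_n -> K) * T)) : Prop :=
  forall a x t, Z (x, t) -> Z (fun i => a * x i, t).

Lemma conical_closure n (Z : set (('I_n -> K) * T)) :
  conical Z -> conical (zclosure (prod_fun (@coord_fun K 'I_n) c) Z).
Proof.
move=> cZ a x t Zx u pu uZ.
pose phi (z : ('I_n -> K) * T) := (fun i => a * z.1 i, z.2).
apply: (Zx (fun z => u (phi z))) => [|[x' t'] Zx']; last by apply: uZ; exact: cZ.
apply: pf_comp pu => h [[_ [i ->] ->]|[g cg ->]].
  apply: pf_mul; first exact: pf_const.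
  by apply: pf_gen; left; exists (fun x => x i) => //; exists i.
by apply: pf_gen; right; exists g.
Qed.

(** A root w of p corresponds to the root 1 / w of q; the extra factor X of q
    takes care of the value 0. *)
Lemma rev_polyX v0 (p : {poly fring v0 K}) : fev v0 p`_0 != 0 ->
  (forall i, pfun c p`_i) ->
  exists q : {poly fring v0 K}, [/\ (1 < size q)%N, (forall i, pfun c q`_i),
    fev v0 (lead_coef q) != 0 &
    forall s v, (s != 0 -> (map_poly (fev v) p).[s^-1] = 0) ->
      (map_poly (fev v) q).[s] = 0].
Proof.
move=> p0 pp; pose D := (size p).-1.
pose q : {poly fring v0 K} := \poly_(i < D.+2) (if i == 0%N then 0 else p`_(D.+1 - i)).
have p0' : p`_(D.+1 - D.+1) != 0.
  by rewrite subnn; apply: contraNneq p0 => ->; rewrite rmorph0.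
have sq : size q = D.+2 by rewrite size_poly_eq.
exists q; split=> [|i||s v ps]; first by rewrite sq.
- rewrite coef_poly; case: ifP => _; last exact: (pf_const c 0).
  by case: ifP => _ //; exact: (pf_const c 0).
- by rewrite lead_coef_poly //= subnn.
have sp : (size (map_poly (fev v) p) <= D.+1)%N.
  by apply: leq_trans (size_poly _ _) _; rewrite /D; case: (size p).
have sq' : (size (map_poly (fev v) q) <= D.+2)%N by rewrite -sq; exact: size_poly.
rewrite (horner_coef_wide _ sq') big_ord_recl coef_map coef_poly /= rmorph0 mul0r add0r.
have [->|s0] := eqVneq s 0.
  by rewrite big1 // => i _; rewrite expr0n mulr0.
rewrite (reindex_inj rev_ord_inj) /=.
transitivity (s ^+ D.+1 * (map_poly (fev v) p).[s^-1]); last by rewrite ps // mulr0.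
rewrite (horner_coef_wide _ sp) mulr_sumr; apply: eq_bigr => i _.
have iD := ltn_ord i.
rewrite !coef_map coef_poly /bump /= add1n ltnS ltn_subrL /= subSS.
rewrite subSS subKn -1?ltnS // [RHS]mulrCA; congr (_ * _).
have DE : D.+1 = ((D - i).+1 + i)%N by rewrite addSn subnK // -ltnS.
by rewrite [X in s ^+ X]DE exprD exprVn mulfK // expf_neq0.
Qed.

End Elimination.

(** The main theorem of elimination theory: the projection of Z, minus the points with
    x = 0, is algebraic.  The image is the union of the t such that Z contains
    ((1, 0, ..., 0), t) and of the image of the closure of the projection of Z that forgets
    the first coordinate.  Outside of the former, Z satisfies an equation with
    invertible leading coefficient in that coordinate, so that this projection is closed. *)
Lemma elim_closed (K : closedFieldType) (T : Type) (c : set (T -> K)) n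
    (Z : set (('I_n -> K) * T)) :
  alg (prod_fun (@coord_fun K 'I_n) c) Z -> conical Z ->
  alg c [set t | exists x, (exists i, x i != 0) /\ Z (x, t)].
Proof.
elim: n Z => [|n ih] Z aZ cZ.
  by apply: (eq_ind _ (alg c) (@alg0 _ _ c)); apply/esym; rewrite -subset0 => t [x [[[]]]].
pose c' := prod_fun (@coord_fun K 'I_n) c.
pose Z1 := [set z : K * (('I_n -> K) * T) | Z (fcons z.1 z.2.1, z.2.2)].
have pcons g : prod_fun (@coord_fun K 'I_n.+1) c g ->
    pfun (prod_fun (@line_fun K) c') (fun z => g (fcons z.1 z.2.1, z.2.2)).
  case=> [[_ [i ->] ->]|[h ch ->]] /=; last first.
    by apply: (@pf_snd _ _ c' _ (@line_fun K) (fun z => h z.2)); apply: pf_gen; right; exists h.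
  case: (unliftP ord0 i) => [j|] ->.
    under eq_fun do rewrite fconsS.
    apply: (@pf_snd _ _ c' _ (@line_fun K) (fun z => z.1 j)); apply: pf_gen; left.
    by exists (fun x => x j) => //; exists j.
  under eq_fun do rewrite fcons0.
  exact: (pf_fst c' (pf_gen (erefl : @line_fun K id))).
have aZ1 : alg (prod_fun (@line_fun K) c') Z1.
  exact: (@alg_preim _ _ _ _ _ (fun z => (fcons z.1 z.2.1, z.2.2)) _ pcons aZ).
pose e0 : 'I_n.+1 -> K := fcons 1 (fun=> 0).
pose T1 := [set t | Z (e0, t)].
have aT1 : alg c T1.
  apply: (@alg_preim _ _ _ _ _ (fun t => (e0, t)) _ _ aZ) => h.
  case=> [[_ [i ->] ->]|[g cg ->]] /=; first exact: pf_const.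
  exact: pf_gen.
(* P is the projection of Z that forgets the first coordinate *)
pose P := [set v : ('I_n -> K) * T | exists s, Z (fcons s v.1, v.2)].
have cP : conical P.
  by move=> a x t [s Zs]; exists (a * s); rewrite /= -fconsZ; exact: cZ.
have aT' := ih _ (@alg_zclosure _ _ c' P) (conical_closure cP).
have main t0 : (forall x, (exists i, x i != 0) -> ~ Z (x, t0)) ->
    forall x, (exists i, x i != 0) -> ~ zclosure c' P (x, t0).
  move=> Zt0 x xn0 Px; pose v0 := (x, t0).
  have [|u pu [ut0 uZ]] := aZ (e0, t0).
    by apply: Zt0; exists ord0; rewrite /e0 fcons0 oner_neq0.
  (* the equation u of Z, restricted to the line from (1, 0) to (1, x'), has a nonzero
     constant coefficient *)
  pose h (z : K * (('I_n -> K) * T)) := u (fcons 1 (fun i => z.1 * z.2.1 i), z.2.2).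
  have ph : pfun (prod_fun (@line_fun K) c') h.
    apply: (@pf_comp _ _ _ _ _
      (fun z : K * (('I_n -> K) * T) => (fcons 1 (fun i => z.1 * z.2.1 i), z.2.2)) u _ pu).
    move=> g [[_ [i ->] ->]|[k ck ->]] /=.
      case: (unliftP ord0 i) => [j|] ->.
        under eq_fun do rewrite fconsS.
        apply: pf_mul; first exact: (pf_fst c' (pf_gen (erefl : @line_fun K id))).
        apply: (@pf_snd _ _ c' _ (@line_fun K) (fun z => z.1 j)).
        by apply: pf_gen; left; exists (fun x => x j) => //; exists j.
      under eq_fun do rewrite fcons0.
      exact: pf_const.
    by apply: (@pf_snd _ _ c' _ (@line_fun K) (fun z => k z.2)); apply: pf_gen; right; exists k.
  have [p pp hE] := pf_line_poly v0 ph.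
  have [|q [sq pq lq qE]] := @rev_polyX _ _ c' v0 p _ pp.
    rewrite -coef_map -horner_coef0 -(hE (0, v0)) /h /=.
    by under eq_fun do rewrite mul0r.
  have [|s|w pw [wv wZ]] := proj_closed aZ1 pq lq sq.
  - move=> [s v] /= Zsv; apply: qE => s0; rewrite -(hE (s^-1, v)) /h /=.
    apply: uZ; have := cZ s^-1 _ _ Zsv.
    by rewrite /= fconsZ mulVf.
  - apply: Zt0; have [i xi] := xn0; exists (lift ord0 i); by rewrite fconsS.
  by move: wv; rewrite (Px w pw) ?eqxx // => v [s Zv]; exact: (wZ (s, v)).
move=> t0 nt0; have Zt0 x : (exists i, x i != 0) -> ~ Z (x, t0).
  by move=> x0 Zx; apply: nt0; exists x.
have [|u pu [ut0 uZ]] := algU aT1 aT' (x := t0).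
  case=> [/Zt0|[x [x0]]]; last exact: main.
  by apply; exists ord0; rewrite /e0 fcons0 oner_neq0.
exists u => //; split=> // t [x [[i xi] Zx]]; apply: uZ.
have [[j xj]|/forallNP x0] := pselect (exists j, x (lift ord0 j) != 0).
  right; exists (fun j => x (lift ord0 j)); split; first by exists j.
  by apply: sub_zclosure; exists (x ord0); rewrite /= -fconsE.
left; rewrite /T1 /=; have x00 : x ord0 != 0.
  by case: (unliftP ord0 i) xi => [j|] -> // /x0.
have := cZ (x ord0)^-1 _ _ Zx; congr (Z (_, t)); apply/funext => j.
case: (unliftP ord0 j) => [k|] ->; first by rewrite /e0 fconsS; have /negP/negPn/eqP -> := x0 k; rewrite mulr0.
by rewrite /e0 fcons0 mulVf.
Qed.

Lemma elim_fin (K : closedFieldType) (T : Type) (c : set (T -> K)) (I : finType)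
    (Z : set ((I -> K) * T)) :
  alg (prod_fun (@coord_fun K I) c) Z ->
  (forall a x t, Z (x, t) -> Z (fun i => a * x i, t)) ->
  alg c [set t | exists x, (exists i, x i != 0) /\ Z (x, t)].
Proof.
move=> aZ cZ; pose phi (z : ('I_#|I| -> K) * T) := (fun i => z.1 (enum_rank i), z.2).
have aZ' : alg (prod_fun (@coord_fun K 'I_#|I|) c) [set z | Z (phi z)].
  apply: alg_preim aZ => h [[_ [i ->] ->]|[g cg ->]].
    by apply: pf_gen; left; exists (fun x => x (enum_rank i)) => //; exists (enum_rank i).
  by apply: pf_gen; right; exists g.
have aT := elim_closed aZ' (fun a x t => cZ a _ t).
apply: (eq_ind _ (alg c) aT); apply/seteqP; split=> t [x [[i xi] Zx]].
  by exists (fun j => x (enum_rank j)); split=> //; exists (enum_val i); rewrite enum_valK.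
exists (fun j => x (enum_val j)); split; first by exists (enum_rank i); rewrite enum_rankK.
by rewrite /= /phi /=; under eq_fun do rewrite enum_rankK.
Qed.

(** * Factorization in two variables *)

Section TwoVariables.
Context (K : closedFieldType).
Implicit Types (c e : {poly K}) (f m h u w : {poly {poly K}}).

Lemma scale_of_eval_eq0 m x0 : map_poly (horner_eval x0) m = 0 ->
  exists m1, m = ('X - x0%:P) *: m1.
Proof.
move=> m0; exists (map_poly (fun p => p %/ ('X - x0%:P)) m).
apply/polyP => i; rewrite coefZ coef_map_id0 ?div0p // mulrC divpK //.
rewrite dvdp_XsubCl; apply/rootP.
by have /polyP/(_ i) := m0; rewrite coef_map coef0.
Qed.

Lemma scale_polyI c u w : c != 0 -> c *: u = c *: w -> u = w.
Proof. by rewrite -!mul_polyC => c0; apply: mulfI; rewrite polyC_eq0. Qed.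

(** The lemma of Gauss: a denominator c in k[x] can be removed from a factorization. *)
Lemma gauss c u m h : c != 0 -> c *: u = m * h -> exists e1 e2 m' h',
  [/\ e1 != 0, e2 != 0, m = e1 *: m', h = e2 *: h' & u = m' * h'].
Proof.
have [n] := ubnP (size c); elim: n c m h => // n ih c m h sc c0 cE.
have [/closed_rootP [x0 /factor_theorem [c' c'E]]|] := boolP (size c != 1%N); last first.
  rewrite negbK => /size_poly1P [a a0 ca].
  exists c, 1, (a^-1%:P *: m), h; rewrite oner_eq0 scale1r scalerA ca -polyCM mulfV //.
  rewrite scale1r polyC_eq0; split=> //.
  by rewrite -scalerAl -cE ca scalerA -polyCM mulVf // scale1r.
have X0 : 'X - x0%:P != 0 by rewrite polyXsubC_eq0.
have c'0 : c' != 0 by apply: contraNneq c0; rewrite c'E => ->; rewrite mul0r.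
have sc' : (size c' < n)%N.
  by move: sc; rewrite c'E size_Mmonic ?monicXsubC // size_XsubC addn2 /= ltnS.
have : map_poly (horner_eval x0) m * map_poly (horner_eval x0) h = 0.
  rewrite -rmorphM -cE c'E; apply/polyP => i.
  by rewrite coef_map coefZ /= /horner_eval !hornerM hornerXsubC subrr mulr0 mul0r coef0.
move/eqP; rewrite mulf_eq0 => /orP[] /eqP /scale_of_eval_eq0 [m1 m1E].
  have [|e1 [e2 [m' [h' [e10 e20 E1 E2 E3]]]]] := ih c' m1 h sc' c'0.
    apply: (scale_polyI X0).
    by rewrite scalerA mulrC -c'E cE m1E scalerAl.
  exists (('X - x0%:P) * e1), e2, m', h'; rewrite mulf_neq0 //; split=> //.
  by rewrite -scalerA -E1.
have [|e1 [e2 [m' [h' [e10 e20 E1 E2 E3]]]]] := ih c' m m1 sc' c'0.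
  apply: (scale_polyI X0).
  by rewrite scalerA mulrC -c'E cE m1E scalerAr.
exists e1, (('X - x0%:P) * e2), m', h'; rewrite mulf_neq0 //; split=> //.
by rewrite -scalerA -E2.
Qed.

Lemma polyC_mul (p q : {poly K}) a : a != 0 -> p * q = a%:P ->
  exists2 b, b != 0 & p = b%:P.
Proof.
move=> a0 pq; have : size (p * q) == 1%N by rewrite pq size_polyC a0.
by rewrite size_mul_eq1 => /andP[/size_poly1P].
Qed.

(** The greatest common divisor of f and u over k(x) has positive degree, and it is
    associate to f because f has no proper factor. *)
Lemma resultant_eq0_dvd f u a : a != 0 -> lead_coef f = a%:P ->
  (forall m h, f = m * h -> (size m <= 1)%N \/ (size h <= 1)%N) ->
  resultant f u = 0 -> exists w, u = w * f.
Proof.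
move=> a0 lf irr /eqP; rewrite resultant_eq0; set g := gcdp f u => sg.
have /Pdiv.WeakIdomain.dvdpP [[c1 g'] /= c10 fE] : g %| f by exact: Pdiv.Idomain.dvdp_gcdl.
have /Pdiv.WeakIdomain.dvdpP [[c2 w] /= c20 uE] : g %| u by exact: Pdiv.Idomain.dvdp_gcdr.
have [e1 [e2 [m' [h [e10 e20 _ gE fE']]]]] := gauss c10 fE.
have [/size1_polyC m'E|] := irr _ _ fE'; last first.
  by move=> sh; move: sg; rewrite gE size_scale // ltnNge sh.
move: m'E; set m0 := m'`_0 => m'E.
have [b b0 m0E] : exists2 b, b != 0 & m0 = b%:P.
  by apply: (@polyC_mul _ (lead_coef h) a) => //; rewrite -lf fE' m'E lead_coefM lead_coefC.
have fE2 : f = b%:P *: h by rewrite fE' m'E m0E mul_polyC.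
have [||e3 [e4 [m2 [f' [e30 e40 _ fE3 uE2]]]]] := @gauss (b%:P * c2) u (e2 *: w) f.
- by rewrite mulf_neq0 // polyC_eq0.
- by rewrite -scalerA uE gE fE2 -!scalerAr -!scalerAl.
have [b' b'0 e4E] : exists2 b, b != 0 & e4 = b%:P.
  by apply: (@polyC_mul _ (lead_coef f') a) => //; rewrite -lf fE3 lead_coefZ.
exists ((b'^-1)%:P *: m2).
by rewrite fE3 uE2 e4E -scalerAl -scalerAr scalerA -polyCM mulVf // scale1r.
Qed.

End TwoVariables.

(** * Specialization of forms *)

Lemma rmorph_mmap (R : comNzRingType) (A B : comNzRingType) n (f : {rmorphism R -> A})
    (g : {rmorphism A -> B}) (h : 'I_n -> A) (p : {mpoly R[n]}) :
  g (mmap f h p) = mmap (g \o f) (fun i => g (h i)) p.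
Proof.
rewrite /mmap rmorph_sum; apply: eq_bigr => m _.
by rewrite rmorphM /mmap1 rmorph_prod; congr (_ * _); apply: eq_bigr => i _; rewrite rmorphXn.
Qed.

(** The j-th vertex of the coordinate simplex. *)
Definition unitvec (R : nzSemiRingType) n (j : 'I_n) (i : 'I_n) : R := (i == j)%:R.

Section TopCoefficient.
Context (R A : comNzRingType) (n : nat) (f : {rmorphism R -> A}).
Context (eta : 'I_n -> A) (j : 'I_n) (d : nat) (p : {mpoly R[n]}).
Hypothesis hp : p \is d.-homog.

(** The substitution of the polynomial variable for the j-th variable and of eta for
    the other ones. *)
Definition subst_var : 'I_n -> {poly A} := fun i => if i == j then 'X else (eta i)%:P.

Let mmap1_subst m : mmap1 subst_var m = (\prod_(i < n | i != j) eta i ^+ m i)%:P * 'X^(m j).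
Proof.
rewrite /mmap1 (bigD1 j) //= /subst_var eqxx mulrC rmorph_prod; congr (_ * _).
by apply: eq_bigr => i /negPf ->; rewrite rmorphXn.
Qed.

Let mdegD1 (m : 'X_{1..n}) : mdeg m = (m j + \sum_(i < n | i != j) m i)%N.
Proof. by rewrite mdegE (bigD1 j). Qed.

Lemma size_mmap_subst : (size (mmap (polyC \o f) subst_var p) <= d.+1)%N.
Proof.
apply: (leq_trans (size_sum _ _ _)); rewrite big_seq; apply/bigmax_leqP_seq => m _ mp.
have md : mdeg m = d := dhomog_mf hp mp.
rewrite mmap1_subst /= mulrA -polyCM mul_polyC.
apply: (leq_trans (size_scale_leq _ _)); rewrite size_polyXn ltnS -md.
by rewrite mdegD1 leq_addr.
Qed.

Lemma coef_mmap_subst : (mmap (polyC \o f) subst_var p)`_d = f p.@[unitvec R j].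
Proof.
rewrite mevalE rmorph_sum coef_sum !big_seq; apply: eq_bigr => m mp.
have md : mdeg m = d := dhomog_mf hp mp.
rewrite mmap1_subst /= mulrA -polyCM coefCM coefXn rmorphM rmorph_prod -mulrA.
congr (_ * _); rewrite [in RHS](bigD1 j) //= /unitvec eqxx expr1n rmorph1 mul1r.
have [dm|dm] := eqVneq d (m j).
  have m0 i : i != j -> m i = 0%N.
    move=> ij; apply/eqP; move: md; rewrite mdegD1 dm -[RHS]addn0 => /addnI/eqP.
    by rewrite sum_nat_eq0 => /forallP/(_ i)/implyP/(_ ij).
  by rewrite mulr1 big1 ?big1 // => i ij; rewrite m0 // expr0 ?rmorph1.
rewrite mulr0; apply/esym; have /existsP [i /andP[ij mi]] : [exists i, (i != j) && (m i != 0%N)].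
  apply: contraNT dm; rewrite negb_exists => /forallP m0.
  rewrite -md mdegD1 big1 ?addn0 // => i ij; apply/eqP.
  by have := m0 i; rewrite ij /= negbK.
rewrite (bigD1 i) //= (negPf ij) expr0n (negPf mi) rmorph0 mul0r //.
Qed.

End TopCoefficient.

(** * Curves in space as cones *)

Section HomogeneousCurves.
Context (K : closedFieldType).
Implicit Types (x p q : 'I_4 -> K) (f g F : {mpoly K[4]}).

(** The cone, without its vertex, over an irreducible closed subset of projective
    space that is not a single point. *)
Definition hcurve (A : set ('I_4 -> K)) : Prop :=
  [/\ exists2 S : set {mpoly K[4]}, (forall f, S f -> exists e, f \is e.-homog) &
        forall x, A x <-> (exists i, x i != 0) /\ (forall f, S f -> f.@[x] = 0),
      forall e f e' g, f \is e.-homog -> g \is e'.-homog ->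
        (forall x, A x -> f.@[x] = 0 \/ g.@[x] = 0) ->
        (forall x, A x -> f.@[x] = 0) \/ (forall x, A x -> g.@[x] = 0) &
      ~ exists c, forall x, A x -> exists s, x = fun i => s * c i].

Lemma homog1_ratio (k l : 'I_4) (a : K) : 'X_k - a *: 'X_l \is 1.-homog.
Proof. by rewrite rpredB ?rpredZ // dhomogX /= mdeg1. Qed.

Lemma hcurve_union A (L : seq {mpoly K[4]}) : hcurve A ->
  (forall f, f \in L -> f \is 1.-homog) ->
  (forall x, A x -> exists2 f, f \in L & f.@[x] = 0) ->
  exists2 f, f \in L & forall x, A x -> f.@[x] = 0.
Proof.
case=> _ irr nsing; elim: L => [|f L ih] hL AL.
  by exfalso; apply: nsing; exists (fun=> 0) => x /AL [].
have hf : f \is 1.-homog by apply: hL; rewrite mem_head.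
have hL' g : g \in L -> g \is 1.-homog by move=> gL; apply: hL; rewrite in_cons gL orbT.
pose G := \prod_(g <- L) g.
have hG : G \is (size L).-homog.
  rewrite /G; elim: (L) hL' => [|g L' ih'] hL'; first by rewrite big_nil dhomog1.
  rewrite big_cons -[size _]add1n; apply: dhomogM; first by apply: hL'; rewrite mem_head.
  by apply: ih' => h hL1; apply: hL'; rewrite in_cons hL1 orbT.
have GE x : G.@[x] = \prod_(g <- L) g.@[x] by rewrite rmorph_prod.
have [x Ax|f0|G0] := irr _ _ _ _ hf hG.
- have [g] := AL x Ax; rewrite in_cons => /predU1P[->|gL g0]; first by left.
  by right; rewrite GE (big_rem g) //= g0 mul0r.
- by exists f => //; rewrite mem_head.
have [//|x Ax|g gL g0] := ih.
  have /eqP := G0 x Ax; rewrite GE prodf_seq_eq0 => /hasP [g gL /= /eqP g0].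
  by exists g.
by exists g => //; rewrite in_cons gL orbT.
Qed.

(** If x_k / x_l takes finitely many values on A, it is constant by irreducibility. *)
Lemma finite_ratio A (N : {poly K}) (a : K) (k l : 'I_4) : hcurve A -> N != 0 -> a != 0 ->
  (forall x, A x -> x l != 0 -> N.[a * (x k / x l)] = 0) ->
  (forall x, A x -> x l = 0) \/ exists c, forall x, A x -> x k = c * x l.
Proof.
move=> hA N0 a0 NA; have [rs NE] := closed_field_poly_normal N.
have [|x Ax|f] := @hcurve_union A ('X_l :: [seq 'X_k - (r / a) *: 'X_l | r <- rs]) hA.
- move=> f; rewrite in_cons => /predU1P[->|/mapP[r _ ->]]; last exact: homog1_ratio.
  by rewrite dhomogX /= mdeg1.
- have [xl|xl] := eqVneq (x l) 0; first by exists 'X_l; rewrite ?mem_head // mevalXU.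
  have /eqP := NA x Ax xl; rewrite NE hornerZ mulf_eq0 lead_coef_eq0 (negPf N0) /=.
  rewrite -rootE root_prod_XsubC => rx; set r := _ * _ in rx.
  exists ('X_k - (r / a) *: 'X_l); first by rewrite in_cons (map_f _ rx) orbT.
  by rewrite mevalB mevalZ !mevalXU /r [a * _]mulrC mulfK // divfK // subrr.
rewrite in_cons => /predU1P[->|/mapP[r _ ->]] f0.
  by left=> x Ax; have := f0 x Ax; rewrite mevalXU.
right; exists (r / a) => x Ax; apply/eqP; rewrite -subr_eq0.
by have := f0 x Ax; rewrite mevalB mevalZ !mevalXU => ->.
Qed.

Lemma pf_line_fun_poly (u : K -> K) : pfun (@line_fun K) u ->
  exists P : {poly K}, forall s, u s = P.[s].
Proof.
elim=> [a|_ ->|g h _ [P PE] _ [Q QE]|g h _ [P PE] _ [Q QE]].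
- by exists a%:P => s; rewrite hornerC.
- by exists 'X => s; rewrite hornerX.
- by exists (P + Q) => s; rewrite hornerD PE QE.
- by exists (P * Q) => s; rewrite hornerM PE QE.
Qed.

Lemma pf_plane_fun_poly (u : K * K -> K) :
  pfun (prod_fun (@line_fun K) (@line_fun K)) u ->
  exists P : {poly {poly K}}, forall z, u z = (P.[z.1%:P]).[z.2].
Proof.
elim=> [a|g|g h _ [P PE] _ [Q QE]|g h _ [P PE] _ [Q QE]].
- by exists a%:P%:P => s; rewrite !hornerC.
- case=> [] [_ -> ->]; first by exists 'X => s; rewrite hornerX hornerC.
  by exists 'X%:P => s; rewrite hornerC hornerX.
- by exists (P + Q) => s; rewrite !hornerD PE QE.
- by exists (P * Q) => s; rewrite !hornerM PE QE.
Qed.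

Lemma alg_cone (S : set {mpoly K[4]}) T (c : set (T -> K)) :
  alg (prod_fun (@coord_fun K 'I_4) c) [set z | forall f, S f -> f.@[z.1] = 0].
Proof.
move=> z /existsNP[f /not_implyP[Sf /eqP fz]]; exists (fun z => f.@[z.1]).
  apply: (@pf_fst _ _ (@coord_fun K 'I_4) _ c (fun x => f.@[x])).
  by apply: pf_meval => i; apply: pf_gen; exists i.
by split=> // z' /(_ f Sf).
Qed.

Lemma pf_coord T (c : set (T -> K)) (i : 'I_4) :
  pfun (prod_fun (@coord_fun K 'I_4) c) (fun z => z.1 i).
Proof. by apply: pf_gen; left; exists (fun x => x i) => //; exists i. Qed.

Lemma homog_eval0 e f x a : f \is e.-homog -> f.@[x] = 0 -> f.@[fun i => a * x i] = 0.
Proof. by move=> hf fx; rewrite (mevalZ_homog _ _ hf) fx mulr0. Qed.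

(** Otherwise x_i has no zero on A; the set of values of x_i / x_j, where x_j is nonzero,
    is algebraic and omits 0, hence finite, so each x_j / x_i is constant and A is a point. *)
Lemma hcurve_meets_plane A i : hcurve A -> exists2 x, A x & x i = 0.
Proof.
move=> hA; have [[S hS SE] irr nsing] := hA.
apply: contrapT => /forall2NP nA; apply: nsing.
have Ai x : A x -> x i != 0 by move=> Ax; apply/eqP => xi; have [] := nA x.
have A0 : exists x, A x.
  apply: contrapT => /forallNP A0; have [_ _] := hA; apply; exists (fun=> 0) => x Ax.
  by case: (A0 x).
suff cj j : exists c, forall x, A x -> x j = c * x i.
  exists (fun j => projT1 (cid (cj j))) => x Ax; exists (x i); apply/funext => j.
  by case: (cid (cj j)) => c /= cE; rewrite cE // mulrC.
pose Z := [set z : ('I_4 -> K) * K | forall f, S f -> f.@[z.1] = 0] `&`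
          [set z | z.1 i = z.2 * z.1 j].
have aZ : alg (prod_fun (@coord_fun K 'I_4) (@line_fun K)) Z.
  apply: algI; first exact: alg_cone.
  apply: alg_eq; first exact: pf_coord.
  apply: pf_mul; last exact: pf_coord.
  exact: (pf_snd _ (pf_gen (erefl : @line_fun K id))).
have [a x t [/= Sx xi]|[x [x0 [/= Sx]]]|u pu [u0 uZ]] := elim_fin aZ _ (x := 0).
- split=> [f Sf|/=]; last by rewrite xi mulrCA.
  by have [e hf] := hS f Sf; apply: homog_eval0 hf _; exact: Sx.
- by rewrite mul0r => /eqP; apply/negP/Ai/SE.
have [P PE] := pf_line_fun_poly pu.
have P0 : P != 0 by apply: contraNneq u0 => P0; rewrite PE P0 horner0.
have [x Ax xj||[c cE]] := @finite_ratio A P 1 i j hA P0 (oner_neq0 _).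
- rewrite mul1r -PE; apply: uZ; exists x; have [x0 Sx] := (SE x).1 Ax; split=> //.
  by split=> //=; rewrite divfK.
- by move=> xj; exists 0 => x /xj ->; rewrite mul0r.
exists c^-1 => x Ax; rewrite cE // mulKf //; apply/eqP => c0.
by have := Ai x Ax; rewrite cE // c0 mul0r eqxx.
Qed.

End HomogeneousCurves.

(** * Pairs of curves whose product lies on a generic surface *)

Section Restrictions.
Context (K : closedFieldType).
Implicit Types (F : {mpoly K[4]}) (i j k l : 'I_4).

Lemma quad_cases i j k l : uniq [:: i; j; k; l] -> forall a, [\/ a = i, a = j, a = k | a = l].
Proof.
move=> u a; have : a \in [:: i; j; k; l].
  apply: contraTT isT => na; have /card_uniqP c5 : uniq [:: a; i; j; k; l] by rewrite cons_uniq na u.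
  by have := max_card (mem [:: a; i; j; k; l]); rewrite c5 card_ord.
by rewrite !inE => /or4P[] /eqP ->; [exact: Or41|exact: Or42|exact: Or43|exact: Or44].
Qed.

(** Points with prescribed coordinates, the other ones being 0. *)
Definition pt2 k l (a b : K) : 'I_4 -> K :=
  fun m => if m == k then a else if m == l then b else 0.
Definition pt3 j k l (a b c : K) : 'I_4 -> K :=
  fun m => if m == j then a else if m == k then b else if m == l then c else 0.

(** The dehomogenized restrictions of F to the edge with coordinates (x_k : x_l), as a
    polynomial in x_k, and to the face (x_j : x_k : x_l), as a polynomial in x_j
    with coefficients in k[x_k].  In both cases x_l = 1. *)
Definition edge_poly F k l : {poly K} :=
  mmap (polyC \o idfun) (subst_var (fun m => (m == l)%:R) k) F.
Definition face_poly F j k l : {poly {poly K}} :=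
  mmap (polyC \o polyC)
    (subst_var (fun m => if m == k then 'X else (m == l)%:R) j) F.

Lemma horner_edge_poly F k l a : (edge_poly F k l).[a] = F.@[pt2 k l a 1].
Proof.
have -> : (edge_poly F k l).[a] = horner_eval a (edge_poly F k l) by [].
rewrite /edge_poly rmorph_mmap /meval /mmap; apply: eq_bigr => m _.
rewrite /= /horner_eval hornerC; congr (_ * _); apply: eq_bigr => i _; congr (_ ^+ _).
by rewrite /subst_var /pt2; case: eqP => _; rewrite ?hornerX // hornerC; case: eqP.
Qed.

Lemma horner_face_poly F j k l y x :
  ((face_poly F j k l).[y%:P]).[x] = F.@[pt3 j k l y x 1].
Proof.
have -> : ((face_poly F j k l).[y%:P]).[x] =
  (horner_eval x \o horner_eval y%:P) (face_poly F j k l) by [].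
rewrite /face_poly rmorph_mmap /meval /mmap; apply: eq_bigr => m _.
rewrite /= /horner_eval !hornerC; congr (_ * _); apply: eq_bigr => i _; congr (_ ^+ _).
rewrite /subst_var /pt3; case: eqP => _; rewrite ?hornerX ?hornerC //.
by case: eqP => _; rewrite ?hornerX //; case: eqP; rewrite hornerC.
Qed.

Lemma swapXY_face_poly F j k l : j != k ->
  swapXY (face_poly F j k l) = face_poly F k j l.
Proof.
move=> jk; rewrite /face_poly.
have -> := @rmorph_mmap K _ _ 4 (polyC \o polyC) (@swapXY K)
  (subst_var (fun m => if m == k then 'X else (m == l)%:R) j) F.
rewrite /mmap; apply: eq_bigr => n _; congr (_ * _).
  by rewrite /= swapXY_polyC map_polyC.
apply: eq_bigr => t _; congr (_ ^+ _); rewrite /subst_var.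
have [->|tj] := eqVneq t j; first by rewrite (negPf jk); exact: swapXY_X.
rewrite -[LHS]/(swapXY _) swapXY_polyC; case: (t == k); first by rewrite map_polyX.
by rewrite !rmorph_nat.
Qed.

Context (d : nat) (F : {mpoly K[4]}) (hF : F \is d.-homog).

Lemma size_edge_poly k l : (size (edge_poly F k l) <= d.+1)%N.
Proof. exact: size_mmap_subst. Qed.

Lemma coef_edge_poly k l : (edge_poly F k l)`_d = F.@[unitvec K k].
Proof. exact: (@coef_mmap_subst _ _ _ idfun). Qed.

Lemma size_face_poly j k l : (size (face_poly F j k l) <= d.+1)%N.
Proof. exact: size_mmap_subst. Qed.

Lemma coef_face_poly j k l : (face_poly F j k l)`_d = (F.@[unitvec K j])%:P.
Proof. exact: (@coef_mmap_subst _ _ _ polyC). Qed.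

Lemma eval_ratio k l x : (forall m, m != k -> m != l -> x m = 0) -> x l != 0 ->
  F.@[x] = 0 -> F.@[pt2 k l (x k / x l) 1] = 0.
Proof.
move=> x0 xl Fx; have := homog_eval0 (x l)^-1 hF Fx; congr (_ = _).
apply: meval_eq => m; rewrite /pt2; have [->|mk] := eqVneq m k; first by rewrite mulrC.
by have [->|ml] := eqVneq m l; rewrite ?mulVf // (x0 m) // mulr0.
Qed.

End Restrictions.

Section GenericForms.
Context (K : closedFieldType).
Implicit Types i j k l : 'I_4.

(** No factorization into two factors of positive degree in the outer variable. *)
Definition indecomposable (f : {poly {poly K}}) : Prop :=
  forall m h, f = m * h -> (size m <= 1)%N \/ (size h <= 1)%N.

(** At least two elements, and no nontrivial scaling into itself. *)
Definition asymmetric (R : set K) : Prop :=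
  (exists r s, [/\ R r, R s & r != s]) /\
  forall a, a != 0 -> (forall r, R r -> R (a * r)) -> a = 1.

(** The genericity needed of the surface F = 0: it contains no vertex of the coordinate
    tetrahedron, its sections by the faces are irreducible, and its points on the edges
    have no scaling symmetry. *)
Definition generic_form (F : {mpoly K[4]}) : Prop :=
  forall i j k l : 'I_4, uniq [:: i; j; k; l] ->
    [/\ F.@[unitvec K i] != 0, indecomposable (face_poly F j k l) &
        asymmetric [set r | F.@[pt2 k l r 1] = 0]].

(** The product on homogeneous coordinates. *)
Definition pmul (p q : 'I_4 -> K) : 'I_4 -> K := fun m => p m * q m.

Lemma pmulC p q : pmul p q = pmul q p.
Proof. by apply/funext => m; rewrite /pmul mulrC. Qed.

Context (d : nat) (F : {mpoly K[4]}) (hF : F \is d.-homog) (gF : generic_form F).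

Let quadP i j k l : uniq [:: i; j; k; l] ->
  [/\ i != j, i != k & i != l] /\ [/\ j != k, j != l & k != l].
Proof.
by rewrite /= !inE !negb_or => /and4P[/and3P[-> -> ->] /andP[-> ->] -> _].
Qed.

Let d_gt0 : (0 < d)%N.
Proof.
pose i0 : 'I_4 := @Ordinal 4 0 isT. pose i1 : 'I_4 := @Ordinal 4 1 isT.
pose i2 : 'I_4 := @Ordinal 4 2 isT. pose i3 : 'I_4 := @Ordinal 4 3 isT.
have [F0 _ [[r [s [Rr _ _]]] _]] := gF (isT : uniq [:: i2; i1; i0; i3]).
rewrite lt0n; apply: contraNneq F0 => d0.
have := hF; rewrite d0 => hF0; have := homog_eval0 0 hF0 Rr.
have e0 : (fun i => 0 * pt2 i0 i3 r 1 i) = (fun i => 0 * unitvec K i2 i).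
  by apply/funext => i; rewrite !mul0r.
by rewrite e0 (mevalZ_homog _ _ hF0) expr0 mul1r => ->.
Qed.

(** Every point of the surface on the edge x_i = x_j = 0 is p * q for some q in Y.  If not,
    the closed set p * Y has an equation P that does not vanish at that point.  Then the
    resultant of P with the equation of the face x_i = 0 is nonzero, so x_k / x_l takes
    finitely many values on Y. *)
Lemma fiber_onto (Y : set ('I_4 -> K)) (p : 'I_4 -> K) i j k l :
  uniq [:: i; j; k; l] -> hcurve Y -> (forall q, Y q -> F.@[pmul p q] = 0) ->
  p i = 0 -> p j != 0 -> p k != 0 -> p l != 0 ->
  (forall q, Y q -> q j = 0 -> q k = 0 -> q l = 0 -> False) ->
  ~ (forall q, Y q -> q l = 0) -> ~ (exists c, forall q, Y q -> q k = c * q l) ->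
  forall r, F.@[pt2 k l r 1] = 0 -> exists2 q, Y q & q j = 0 /\ p k * q k = r * (p l * q l).
Proof.
move=> u hY FY pi pj pk pl Yi Yl Ykl r Fr; have [[ij ik il] [jk jl kl]] := quadP u.
have u' : uniq [:: j; i; k; l].
  by rewrite /= !inE !negb_or eq_sym ij ik il jk jl kl.
have [Fj _ _] := gF u'.
have [_ irr _] := gF u; have [[S hS SE] _ _] := hY.
apply: contrapT => /forall2NP nr.
pose Z := [set z : ('I_4 -> K) * (K * K) | forall f, S f -> f.@[z.1] = 0] `&`
   ([set z | p j * z.1 j = z.2.1 * (p l * z.1 l)] `&`
    [set z | p k * z.1 k = z.2.2 * (p l * z.1 l)]).
pose c := prod_fun (@line_fun K) (@line_fun K).
have pline : @line_fun K id by [].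
have pconst a m : pfun (prod_fun (@coord_fun K 'I_4) c) (fun z => a * z.1 m).
  by apply: pf_mul; [exact: pf_const|exact: pf_coord].
have aZ : alg (prod_fun (@coord_fun K 'I_4) c) Z.
  apply: algI; first exact: alg_cone.
  apply: algI; apply: alg_eq => //; apply: pf_mul => //.
    apply: (@pf_snd _ _ c _ (@coord_fun K 'I_4) (fun z => z.1)).
    exact: (pf_fst _ (pf_gen pline)).
  apply: (@pf_snd _ _ c _ (@coord_fun K 'I_4) (fun z => z.2)).
  exact: (pf_snd _ (pf_gen pline)).
have [a q t [/= Sq [qj qk]]|[q [q0 [/= Sq [qj qk]]]]|w pw [w0 wZ]] :=
    elim_fin aZ _ (x := (0, r)).
- split=> [f Sf|/=]; first by have [e hf] := hS f Sf; apply: homog_eval0 hf _; exact: Sq.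
  by split; rewrite /= mulrCA ?qj ?qk (mulrCA (p l)) [RHS]mulrCA.
- have Yq : Y q by exact/SE.
  have [//|] := nr q; apply; split=> //.
  by move/eqP: qj; rewrite mul0r mulf_eq0 (negPf pj) => /eqP.
have [P PE] := pf_plane_fun_poly pw.
set f := face_poly F j k l.
have P0 : P != 0 by apply: contraNneq w0 => P0; rewrite PE P0 !horner0.
(* the factor 'X + 1 makes the degree positive, without a zero on the line y = 0 *)
pose P' := P * ('X + 1%:P).
have sP' : (1 < size P')%N.
  by rewrite /P' size_Mmonic ?monicXaddC // size_XaddC addn2 /= ltnS size_poly_gt0.
have lf : lead_coef f = (F.@[unitvec K j])%:P.
  have sf : size f = d.+1.
    apply/eqP; rewrite eqn_leq size_face_poly //= ltnNge.
    apply: contra Fj => sf; rewrite -(polyC_eq0 F.@[_]) -(coef_face_poly hF _ k l).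
    by rewrite nth_default.
  by rewrite lead_coefE sf /= (coef_face_poly hF).
have sf : (1 < size f)%N.
  rewrite ltnNge; apply/negP => sf; move: lf; rewrite lead_coefE.
  have : f`_d = (F.@[unitvec K j])%:P by exact: coef_face_poly.
  by rewrite nth_default ?(leq_trans sf) // => /esym/eqP; rewrite polyC_eq0 (negPf Fj).
have [/(resultant_eq0_dvd Fj lf irr) [v P'E]|N0] := eqVneq (resultant f P') 0.
  have : (P'.[0%:P]).[r] = 0.
    rewrite P'E !hornerM horner_face_poly.
    have -> : F.@[pt3 j k l 0 r 1] = F.@[pt2 k l r 1].
      apply: meval_eq => m; rewrite /pt3 /pt2.
      by have [->|] := eqVneq m j; rewrite ?(negPf jk) ?(negPf jl).
    by rewrite Fr mulr0.
  rewrite !hornerM !hornerD !hornerX !hornerC add0r mulr1 => P0r.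
  by move: w0; rewrite PE /= P0r eqxx.
have pkl0 : p k / p l != 0 by rewrite mulf_neq0 // invr_eq0.
have [q Yq ql||] := finite_ratio (k := k) (l := l) hY N0 pkl0; [|exact: Yl|exact: Ykl].
have ql' : p l * q l != 0 by rewrite mulf_neq0.
set x := _ * _; pose y := p j * q j / (p l * q l).
have xE : x = p k * q k / (p l * q l) by rewrite /x mulf_div.
have Fy : ((f.[y%:P]).[x]) = 0.
  rewrite horner_face_poly; have := homog_eval0 (p l * q l)^-1 hF (FY q Yq).
  congr (_ = _); apply: meval_eq => m; rewrite /pt3 /pmul.
  have [->|->|->|->] := quad_cases u m.
  - by rewrite (negPf ij) (negPf ik) (negPf il) pi mul0r mulr0.
  - by rewrite eqxx mulrC.
  - by rewrite [k == j]eq_sym (negPf jk) eqxx mulrC xE.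
  - by rewrite [l == j]eq_sym (negPf jl) [l == k]eq_sym (negPf kl) eqxx mulVf.
have Py : ((P'.[y%:P]).[x]) = 0.
  rewrite !hornerM; have := PE (y, x); rewrite /= => <-; rewrite wZ ?mul0r //.
  exists q; have [q0 Sq] := (SE q).1 Yq; split=> //; split=> //=.
  by split; rewrite /= ?xE divfK.
rewrite -[LHS]/(horner_eval x (resultant f P')).
apply: (@resultant_root _ _ (horner_eval x) f P' y) => //.
- by rewrite -Fy -horner_evalE -[in RHS]/(horner_eval x f.[y%:P]) -horner_map /= /horner_eval hornerC.
- by rewrite -Py -[in RHS]/(horner_eval x P'.[y%:P]) -horner_map /= /horner_eval hornerC.
Qed.

Let coordinate_point (p : 'I_4 -> K) i j k l : uniq [:: i; j; k; l] ->
  F.@[p] = 0 -> p j = 0 -> p k = 0 -> p l = 0 -> p i = 0.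
Proof.
move=> u Fp pj pk pl; have [Fi _ _] := gF u; apply: contraNeq Fi => pi.
have -> : F.@[unitvec K i] = F.@[fun m => (p i)^-1 * p m].
  apply: meval_eq => m; rewrite /unitvec.
  have [[ij ik il] _] := quadP u.
  have [->|->|->|->] := quad_cases u m; rewrite ?eqxx ?mulVf // eq_sym.
  - by rewrite (negPf ij) pj mulr0.
  - by rewrite (negPf ik) pk mulr0.
  - by rewrite (negPf il) pl mulr0.
by rewrite (homog_eval0 _ hF Fp).
Qed.

(** The transversal position: the points p of X with p_i = 0 and the points q of Y with
    q_j = 0 have no other vanishing coordinate. *)
Lemma no_transversal_pair (X Y : set ('I_4 -> K)) i j k l : uniq [:: i; j; k; l] ->
  hcurve X -> hcurve Y -> (forall p q, X p -> Y q -> F.@[pmul p q] = 0) ->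
  (forall p, X p -> p i = 0 -> [/\ p j != 0, p k != 0 & p l != 0]) ->
  (forall q, Y q -> q j = 0 -> [/\ q i != 0, q k != 0 & q l != 0]) ->
  (forall p, X p -> p i = 0 -> p k = 0 -> p l = 0 -> False) ->
  (forall q, Y q -> q j = 0 -> q k = 0 -> q l = 0 -> False) ->
  ~ (forall p, X p -> p l = 0) -> ~ (forall q, Y q -> q l = 0) ->
  ~ (exists c, forall p, X p -> p k = c * p l) ->
  ~ (exists c, forall q, Y q -> q k = c * q l) -> False.
Proof.
move=> u hX hY FXY Xi Yj Xe Ye Xl Yl Xkl Ykl.
have [[ij ik il] [jk jl kl]] := quadP u.
have u' : uniq [:: j; i; k; l].
  by rewrite /= !inE !negb_or eq_sym ij ik il jk jl kl.
have [_ _ [[r1 [r2 [/= R1 R2 r12]]] asym]] := gF u.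
have [p Xp pi] := hcurve_meets_plane i hX.
have [pj pk pl] := Xi p Xp pi.
have Fp q : Y q -> F.@[pmul p q] = 0 by exact: FXY.
have onto := fiber_onto u hY Fp pi pj pk pl Ye Yl Ykl.
have [q1 Yq1 [q1j q1E]] := onto _ R1; have [q2 Yq2 [q2j q2E]] := onto _ R2.
have [q1i q1k q1l] := Yj _ Yq1 q1j; have [q2i q2k q2l] := Yj _ Yq2 q2j.
have r10 : r1 != 0.
  by apply: contraNneq (mulf_neq0 pk q1k) => r0; rewrite q1E r0 mul0r.
pose a := (q2 k / q2 l) / (q1 k / q1 l).
have aE : a = r2 / r1.
  have -> : r2 = p k * q2 k / (p l * q2 l) by rewrite q2E mulfK // mulf_neq0.
  have -> : r1 = p k * q1 k / (p l * q1 l) by rewrite q1E mulfK // mulf_neq0.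
  have E q : p k * q k / (p l * q l) = (p k / p l) * (q k / q l) by rewrite mulf_div.
  by rewrite !E -mulf_div divff ?mul1r // mulf_neq0 // invr_eq0.
suff a1 : a = 1.
  by move/eqP: r12; apply; apply/esym; rewrite -[RHS]mul1r -a1 aE divfK.
apply: asym => [|r /= Fr].
  by rewrite /a !mulf_neq0 ?invr_eq0 ?mulf_neq0 ?invr_eq0.
have FX q : Y q -> forall p', X p' -> F.@[pmul q p'] = 0.
  by move=> Yq p' Xp'; rewrite pmulC FXY.
have [p' Xp' [p'i p'E]] :=
  fiber_onto u' hX (FX _ Yq1) q1j q1i q1k q1l Xe Xl Xkl Fr.
have [p'j p'k p'l] := Xi _ Xp' p'i.
have -> : a * r = pmul p' q2 k / pmul p' q2 l.
  have -> : r = q1 k * p' k / (q1 l * p' l) by rewrite p'E mulfK // mulf_neq0.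
  have E (u1 u2 v1 v2 : K) : u1 * v1 / (u2 * v2) = (u1 / u2) * (v1 / v2) by rewrite mulf_div.
  by rewrite /pmul !E /a mulrA divfK ?mulf_neq0 ?invr_eq0 // mulrC.
apply: (eval_ratio hF) => //; last 2 first.
- by rewrite /pmul mulf_neq0.
- exact: FXY.
move=> m mk ml; rewrite /pmul; have [->|->|mE|mE] := quad_cases u m.
- by rewrite p'i mul0r.
- by rewrite q2j mulr0.
- by rewrite mE eqxx in mk.
- by rewrite mE eqxx in ml.
Qed.

(** The product of X and Y lies on the surface F = 0, but in no plane x_i = a x_j. *)
Definition hadamard_pair (X Y : set ('I_4 -> K)) : Prop :=
  [/\ hcurve X, hcurve Y, forall p q, X p -> Y q -> F.@[pmul p q] = 0 &
      forall i j a, i != j -> ~ forall p q, X p -> Y q -> pmul p q i = a * pmul p q j].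

Lemma hadamard_pairC X Y : hadamard_pair X Y -> hadamard_pair Y X.
Proof.
case=> hX hY FXY nXY; split=> // [p q Yp Xq|i j a ij XY]; first by rewrite pmulC FXY.
by apply: (nXY i j a ij) => p q Xp Yq; rewrite pmulC XY.
Qed.

Lemma hadamard_pair_plane X Y i : hadamard_pair X Y -> ~ (forall p, X p -> p i = 0).
Proof.
case=> _ _ _ nXY X0; have [j ij] : exists j, i != j.
  by exists (lift i ord0); exact: neq_lift.
by apply: (nXY i j 0 ij) => p q /X0 pi _; rewrite /pmul pi !mul0r.
Qed.

Lemma hadamard_pair_vertex X Y i j k l p : hadamard_pair X Y -> uniq [:: i; j; k; l] ->
  X p -> p j = 0 -> p k = 0 -> p l = 0 -> False.
Proof.
move=> XY u Xp pj pk pl; have [hX hY FXY nXY] := XY.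
apply: (hadamard_pair_plane (i := i) (hadamard_pairC XY)) => q Yq.
have := coordinate_point u (FXY _ _ Xp Yq); rewrite /pmul pj pk pl !mul0r => /(_ erefl erefl erefl).
move/eqP; rewrite mulf_eq0 => /orP[/eqP pi|/eqP //].
have [[S hS SE] _ _] := hX; have [[m pm] _] := (SE p).1 Xp.
by move: pm; have [->|->|->|->] := quad_cases u m; rewrite ?pi ?pj ?pk ?pl eqxx.
Qed.

(** If X meets the edge x_i = x_j = 0, then Y lies in a plane x_k = c x_l. *)
Lemma hadamard_pair_edge X Y i j k l p : hadamard_pair X Y -> uniq [:: i; j; k; l] ->
  X p -> p i = 0 -> p j = 0 -> exists c, forall q, Y q -> q k = c * q l.
Proof.
move=> XY u Xp pi pj; have [hX hY FXY nXY] := XY.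
have [[ij ik il] [jk jl kl]] := quadP u.
have uk : uniq [:: k; i; j; l].
  by rewrite /= !inE !negb_or ![k == _]eq_sym ik jk ij il jl [l == k]eq_sym kl.
have ul : uniq [:: l; i; j; k].
  by rewrite /= !inE !negb_or ![l == _]eq_sym il jl kl ij ik jk.
have pk : p k != 0.
  by apply/eqP => pk; apply: (hadamard_pair_vertex XY ul Xp).
have pl : p l != 0.
  by apply/eqP => pl; apply: (hadamard_pair_vertex XY uk Xp).
have [Fk _ _] := gF uk.
have N0 : edge_poly F k l != 0.
  by apply: contraNneq Fk => N0; rewrite -(coef_edge_poly hF k l) N0 coef0.
have [|q Yq ql|q0|//] := @finite_ratio _ Y (edge_poly F k l) (p k / p l) k l hY N0.
- by rewrite mulf_neq0 // invr_eq0.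
- rewrite horner_edge_poly mulf_div; apply: (@eval_ratio _ _ _ hF _ _ (pmul p q)).
  + move=> m mk ml; rewrite /pmul; have [->|->|mE|mE] := quad_cases u m.
    * by rewrite pi mul0r.
    * by rewrite pj mul0r.
    * by rewrite mE eqxx in mk.
    * by rewrite mE eqxx in ml.
  + by rewrite /pmul mulf_neq0.
  + exact: FXY.
by have := hadamard_pair_plane (i := l) (hadamard_pairC XY) q0.
Qed.

Let quad_rot n i j k l : uniq [:: i; j; k; l] -> uniq (rot n [:: i; j; k; l]).
Proof. by rewrite rot_uniq. Qed.

Let quad_swap i j k l : uniq [:: i; j; k; l] -> uniq [:: j; i; k; l].
Proof.
move=> u; have [[ij ik il] [jk jl kl]] := quadP u.
by rewrite /= !inE !negb_or eq_sym ij ik il jk jl kl.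
Qed.

(** If X meets the edge x_i = x_j = 0, the equations x_k = c x_l of Y and x_i = c' x_j of X
    make the position of X at x_k = 0 and of Y at x_i = 0 transversal. *)
Lemma hadamard_pair_no_edge X Y i j k l p : hadamard_pair X Y -> uniq [:: i; j; k; l] ->
  X p -> p i = 0 -> p j = 0 -> False.
Proof.
move=> XY u Xp pi pj; have YX := hadamard_pairC XY; have [hX hY FXY nXY] := XY.
have [[ij ik il] [jk jl kl]] := quadP u.
have u2 : uniq [:: k; l; i; j] := quad_rot 2 u.
have uj := quad_swap u.
have ul : uniq [:: l; i; j; k] := quad_rot 3 u.
have ukl : uniq [:: k; i; j; l] := quad_rot 1 (quad_swap u2).
have [c Yc] := hadamard_pair_edge XY u Xp pi pj.
have c0 : c != 0.
  apply/eqP => c0; apply: (hadamard_pair_plane (i := k) YX) => q Yq.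
  by rewrite Yc // c0 mul0r.
have Yk q : Y q -> (q k == 0) = (q l == 0).
  by move=> Yq; rewrite Yc // mulf_eq0 (negPf c0).
have [q Yq qk] := hcurve_meets_plane k hY.
have ql : q l = 0 by apply/eqP; rewrite -Yk // qk.
have [c' Xc'] := hadamard_pair_edge YX u2 Yq qk ql.
have c'0 : c' != 0.
  apply/eqP => c'0; apply: (hadamard_pair_plane (i := i) XY) => p' Xp'.
  by rewrite Xc' // c'0 mul0r.
have Xi p' : X p' -> (p' i == 0) = (p' j == 0).
  by move=> Xp'; rewrite Xc' // mulf_eq0 (negPf c'0).
apply: (@no_transversal_pair X Y k i j l ukl hX hY FXY).
- move=> p' Xp' p'k; have p'j : p' j != 0.
    apply/negP => p'j; apply: (hadamard_pair_vertex XY ul Xp') => //; apply/eqP => //.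
    by rewrite Xi.
  split=> //; first by rewrite Xi.
  apply/eqP => p'l; have [c'' Yc''] := hadamard_pair_edge XY u2 Xp' p'k p'l.
  apply: (nXY i j (c' * c'') ij) => p1 q1 Xp1 Yq1.
  by rewrite /pmul Xc' // Yc'' // mulrACA.
- move=> q' Yq' q'i; have q'l : q' l != 0.
    apply/negP => q'l; apply: (hadamard_pair_vertex YX uj Yq') => //; apply/eqP => //.
    by rewrite Yk.
  split=> //; first by rewrite Yk.
  apply/eqP => q'j; have [c'' Xc''] := hadamard_pair_edge YX u Yq' q'i q'j.
  apply: (nXY k l (c'' * c) kl) => p1 q1 Xp1 Yq1.
  by rewrite /pmul Xc'' // Yc // mulrACA.
- by move=> p' Xp' p'k p'j p'l; exact: (hadamard_pair_vertex XY u Xp').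
- by move=> q' Yq' q'i q'j q'l; exact: (hadamard_pair_vertex YX u2 Yq').
- exact: hadamard_pair_plane XY.
- exact: hadamard_pair_plane YX.
- case=> e Xe; have [p' Xp' p'l] := hcurve_meets_plane l hX.
  have p'j : p' j = 0 by rewrite Xe // p'l mulr0.
  apply: (hadamard_pair_vertex XY u2 Xp') => //; apply/eqP.
  by rewrite Xi // p'j.
case=> e Ye; have [q' Yq' q'j] := hcurve_meets_plane j hY.
have e0 : e != 0.
  apply/eqP => e0; apply: (hadamard_pair_plane (i := j) YX) => q1 Yq1.
  by rewrite Ye // e0 mul0r.
have q'l : q' l = 0.
  by apply/eqP; have := Ye _ Yq'; rewrite q'j => /esym/eqP; rewrite mulf_eq0 (negPf e0).
apply: (hadamard_pair_vertex YX u Yq') => //; apply/eqP.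
by rewrite Yk // q'l.
Qed.

Lemma generic_no_hadamard_pair X Y : ~ hadamard_pair X Y.
Proof.
move=> XY; have YX := hadamard_pairC XY; have [hX hY FXY nXY] := XY.
pose i : 'I_4 := @Ordinal 4 0 isT. pose j : 'I_4 := @Ordinal 4 1 isT.
pose k : 'I_4 := @Ordinal 4 2 isT. pose l : 'I_4 := @Ordinal 4 3 isT.
have noedge A B p a b c e : hadamard_pair A B -> uniq [:: a; b; c; e] -> A p ->
    p a = 0 -> p b != 0.
  move=> AB u Ap pa; apply/eqP => pb.
  exact: (hadamard_pair_no_edge AB u Ap pa pb).
apply: (@no_transversal_pair X Y i j k l isT hX hY FXY).
- move=> p Xp pi; split; first exact: (@noedge X Y p i j k l).
    exact: (@noedge X Y p i k j l).
  exact: (@noedge X Y p i l j k).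
- move=> p Yp pj; split; first exact: (@noedge Y X p j i k l).
    exact: (@noedge Y X p j k i l).
  exact: (@noedge Y X p j l i k).
- move=> p Xp pi /eqP; have /negPf -> // := @noedge X Y p i k j l XY isT Xp pi.
- move=> p Yp pj /eqP; have /negPf -> // := @noedge Y X p j k i l YX isT Yp pj.
- exact: hadamard_pair_plane XY.
- exact: hadamard_pair_plane YX.
- case=> c Xc; have [p Xp pl] := hcurve_meets_plane l hX.
  by have := @noedge X Y p l k i j XY isT Xp pl; rewrite Xc // pl mulr0 eqxx.
case=> c Yc; have [p Yp pl] := hcurve_meets_plane l hY.
by have := @noedge Y X p l k i j YX isT Yp pl; rewrite Yc // pl mulr0 eqxx.
Qed.

End GenericForms.

(** * Very general points of a projective space *)

Lemma very_general_all (T : topologicalType) (x0 : T) (I : countType) (Q : I -> T -> Prop) :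
  (forall i, very_general (Q i)) -> very_general (fun w => forall i, Q i w).
Proof.
move=> gQ; pose B i := projT1 (cid (gQ i)).
have BP i : (forall k, closed (B i k) /\ B i k <> setT) /\
    forall w, ~ (\bigcup_k B i k) w -> Q i w.
  by rewrite /B; case: cid.
exists (fun n => if (unpickle n : option (I * nat)) is Some z then B z.1 z.2 else set0).
split=> [n|w nw i].
  case: unpickle => [z|]; first exact: (BP z.1).1.
  split; first exact: closed0.
  by move=> e; have : [set: T] x0 by []; rewrite -e.
apply: (BP i).2 => -[k _ Bk]; apply: nw; exists (pickle (i, k)) => //.
by rewrite pickleK.
Qed.

Lemma very_general_imp (T : topologicalType) (x0 : T) (P : Prop) (Q : T -> Prop) :
  (P -> very_general Q) -> very_general (fun w => P -> Q w).
Proof.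
have [p /(_ p) [B [hB BQ]]|np _] := pselect P; first by exists B; split=> // w /BQ.
exists (fun=> set0); split=> // _; split; first exact: closed0.
by move=> e; have : [set: T] x0 by []; rewrite -e.
Qed.

Lemma very_general_and (T : topologicalType) (x0 : T) (Q Q' : T -> Prop) :
  very_general Q -> very_general Q' -> very_general (fun w => Q w /\ Q' w).
Proof.
move=> gQ gQ'; have [|B [hB BQ]] := very_general_all x0 (Q := fun b : bool => if b then Q else Q').
  by case.
by exists B; split=> // w /BQ h; split; [exact: (h true)|exact: (h false)].
Qed.

(** The linear forms on V, taken as its coordinates. *)
Definition lin_fun (K : fieldType) (V : lmodType K) : set (V -> K) :=
  [set g | forall a u v, g (a *: u + v) = a * g u + g v].

Section VeryGeneral.
Context (K : closedFieldType) (V : vectType K).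

Lemma pf_lin_mpoly (g : V -> K) : pfun (@lin_fun K V) g ->
  exists p : {mpoly K[\dim {:V}]}, forall v, g v = p.@[fun i => coord (vbasis {:V}) i v].
Proof.
elim=> [a|h lh|g1 g2 _ [p1 E1] _ [p2 E2]|g1 g2 _ [p1 E1] _ [p2 E2]].
- by exists a%:MP => v; rewrite mevalC.
- have h0 : h 0 = 0.
    have := lh 1 0 0; rewrite scaler0 addr0 mul1r -{1}[h 0]addr0.
    by move/addrI.
  exists (\sum_(i < \dim {:V}) h (vbasis {:V})`_i *: 'X_i) => v.
  rewrite {1}(coord_vbasis (memvf v)) raddf_sum /=.
  rewrite (big_morph h (id1 := 0) (op1 := +%R)) //; last first.
    by move=> x y; have := lh 1 x y; rewrite scale1r mul1r.
  apply: eq_bigr => i _; rewrite mevalZ mevalXU mulrC.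
  by have := lh (coord (vbasis {:V}) i v) (vbasis {:V})`_i 0; rewrite h0 !addr0.
- by exists (p1 + p2) => v; rewrite mevalD E1 E2.
- by exists (p1 * p2) => v; rewrite mevalM E1 E2.
Qed.

(** A conical algebraic set that misses a vector is avoided by the very general point:
    the homogeneous components of a polynomial function vanishing on it also vanish on it. *)
Lemma very_general_alg (Z : set V) (v0 : V) : alg (@lin_fun K V) Z ->
  (forall a v, a != 0 -> Z (a *: v) -> Z v) -> v0 != 0 -> ~ Z v0 ->
  very_general (fun w : projspace V => forall v, represents v w -> ~ Z v).
Proof.
move=> aZ cZ v00 Zv0; have [u pu [u0 uZ]] := aZ _ Zv0.
have [p pE] := pf_lin_mpoly pu.
pose ev v := fun i => coord (vbasis {:V}) i v.
pose N := (mmeasure mdeg p).+1.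
have pN : p = \sum_(e < N) pihomog mdeg e p by apply: pihomog_partitionE.
have [e e0] : exists e : 'I_N, (pihomog mdeg e p).@[ev v0] != 0.
  apply: contrapT => /forallNP e0; move: u0; rewrite pE pN raddf_sum /= big1 ?eqxx //.
  by move=> e _; apply/eqP/negPn/negP/e0.
pose g v := (pihomog mdeg e p).@[ev v].
exists (fun=> zeros [set g]); split=> [_|w nw v rv Zv].
  split.
    apply/closed_zariski; exists [set g] => // _ ->; exists (e : nat), (pihomog mdeg e p).
    by split=> //; exact: pihomogP.
  have dv0 : \dim <[v0]>%VS == 1%N by rewrite dim_vline v00.
  move=> zT; have : [set: projspace V] (exist _ <[v0]>%VS dv0) by [].
  by rewrite -zT => /(_ g erefl v0 erefl) /eqP; apply/negP.
apply: nw; exists 0%N => // _ -> {}v' rv'.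
have [c c0 ->] := represents_scale rv rv'.
have Zc a : a != 0 -> Z (a *: v).
  by move=> a0; apply: (cZ a^-1); rewrite ?invr_eq0 // scalerA mulVf // scale1r.
have hom a e' : (pihomog mdeg e' p).@[ev (a *: v)] = a ^+ e' * (pihomog mdeg e' p).@[ev v].
  rewrite -(mevalZ_homog _ _ (pihomogP mdeg e' p)); apply: meval_eq => i.
  by rewrite /ev linearZ.
pose P : {poly K} := \poly_(i < N) (pihomog mdeg i p).@[ev v].
have P0 : P = 0.
  apply/eqP; apply: contraT => P0.
  have : P * 'X != 0 by rewrite mulf_neq0 // polyX_eq0.
  move=> /closed_nonrootP [a]; rewrite rootE hornerM hornerX mulf_eq0 negb_or => /andP[Pa a0].
  move/eqP: Pa; case; rewrite -[RHS](uZ _ (Zc a a0)) pE horner_poly [in RHS]pN raddf_sum /=.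
  by apply: eq_bigr => i _; rewrite -/(ev _) hom mulrC.
rewrite /g hom; have := congr1 (fun q : {poly K} => q`_e) P0.
by rewrite coef_poly ltn_ord coef0 => ->; rewrite mulr0.
Qed.

End VeryGeneral.

(** * Binary forms and bounded bivariate polynomials *)

Section Asymmetry.
Context (K : closedFieldType).

(** A scaling of the set of roots preserves their sum, which is nonzero because the
    subleading coefficient is; the roots are simple, so the sum is read off there. *)
Lemma asymmetric_roots d (n : {poly K}) : (1 < d)%N -> (size n <= d.+1)%N -> n`_d != 0 ->
  n`_d.-1 != 0 -> n.[0] != 0 -> (forall r, n.[r] = 0 -> n^`().[r] != 0) ->
  asymmetric [set r | n.[r] = 0].
Proof.
move=> d1 sn nd nd1 n0 sep.
have sn' : size n = d.+1.
  by apply/eqP; rewrite eqn_leq sn /= ltnNge; apply: contra nd => s; rewrite nth_default.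
have nn0 : n != 0 by rewrite -size_poly_gt0 sn'.
have [rs nE] := closed_field_poly_normal n.
have nrs r : n.[r] = 0 <-> r \in rs.
  rewrite nE hornerZ -(root_prod_XsubC rs r) rootE; split=> [/eqP|/eqP ->]; last by rewrite mulr0.
  by rewrite mulf_eq0 lead_coef_eq0 (negPf nn0).
have srs : size rs = d.
  by apply: succn_inj; rewrite -sn' nE size_scale ?lead_coef_eq0 // size_prod_XsubC.
have urs : uniq rs.
  rewrite -(separable_prod_XsubC rs).
  have : separable_poly n.
    by rewrite unlock; apply: Pdiv.ClosedField.root_coprimep => r /rootP/sep.
  by apply: dvdp_separable; rewrite nE dvdpZr ?lead_coef_eq0.
have sum0 : \sum_(r <- rs) r != 0.
  apply: contraNneq nd1 => s0.
  by rewrite nE coefZ -srs coefPn_prod_XsubC ?srs -?lt0n ?(ltnW d1) // s0 oppr0 mulr0.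
split.
  exists rs`_0, rs`_1; split; try by apply/nrs/mem_nth; rewrite srs ?(ltnW d1).
  by rewrite nth_uniq // srs // ltnW.
move=> a a0 aR.
have ua : uniq [seq a * r | r <- rs] by rewrite map_inj_uniq //; exact: mulfI.
have sub : {subset [seq a * r | r <- rs] <= rs}.
  by move=> _ /mapP[r rrs ->]; apply/nrs/aR/nrs.
have [_ aE] := uniq_min_size ua sub (eq_leq (esym (size_map _ rs))).
have : \sum_(r <- [seq a * r | r <- rs]) r = \sum_(r <- rs) r.
  exact: (perm_big _ (uniq_perm ua urs aE)).
rewrite big_map -mulr_sumr -[RHS]mul1r => /(mulIf sum0).
by [].
Qed.

End Asymmetry.

Section BinaryForms.
Context (K : comNzRingType).

(** The binary form of degree D with dehomogenization n. *)
Definition homogenize (n : {poly K}) D (a b : K) : K :=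
  \sum_(m < D.+1) n`_m * (a ^+ m * b ^+ (D - m)).

Lemma homogenize_scale t n D a b : homogenize (t *: n) D a b = t * homogenize n D a b.
Proof. by rewrite /homogenize mulr_sumr; apply: eq_bigr => m _; rewrite coefZ mulrA. Qed.

Lemma homogenizeZ n D t a b : homogenize n D (t * a) (t * b) = t ^+ D * homogenize n D a b.
Proof.
rewrite /homogenize mulr_sumr; apply: eq_bigr => m _.
have mD : (m <= D)%N by rewrite -ltnS.
have -> : t ^+ D = t ^+ m * t ^+ (D - m) by rewrite -exprD subnKC.
by rewrite !exprMn [in LHS]mulrACA [LHS]mulrCA.
Qed.

Lemma homogenize_horner (n : {poly K}) D a : (size n <= D.+1)%N -> homogenize n D a 1 = n.[a].
Proof.
move=> sn; rewrite (horner_coef_wide _ sn); apply: eq_bigr => m _.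
by rewrite expr1n mulr1.
Qed.

End BinaryForms.

Section BoundedBivariate.
Context (K : closedFieldType).

(** The polynomial of degrees at most a and D with coefficients m. *)
Definition bipoly a D (m : 'I_a.+1 * 'I_D.+1 -> K) : {poly {poly K}} :=
  \poly_(i < a.+1) \poly_(j < D.+1) m (inord i, inord j).

Lemma size_bipoly a D (m : 'I_a.+1 * 'I_D.+1 -> K) : (size (bipoly m) <= a.+1)%N.
Proof. exact: size_poly. Qed.

Lemma coef_bipoly a D (m : 'I_a.+1 * 'I_D.+1 -> K) i j :
  (bipoly m)`_i`_j = if (i < a.+1)%N && (j < D.+1)%N then m (inord i, inord j) else 0.
Proof. by rewrite coef_poly; case: ltnP => _; rewrite ?coef0 // coef_poly. Qed.

Lemma bipoly_eq0 a D (m : 'I_a.+1 * 'I_D.+1 -> K) : bipoly m = 0 -> forall z, m z = 0.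
Proof.
move=> m0 [i j]; have := coef_bipoly m i j.
by rewrite m0 !coef0 !ltn_ord !inord_val.
Qed.

Lemma bipolyZ a D (m : 'I_a.+1 * 'I_D.+1 -> K) t :
  bipoly (fun z => t * m z) = t%:P *: bipoly m.
Proof.
apply/polyP => i; apply/polyP => j; rewrite coefZ coefCM !coef_bipoly.
by case: ifP; rewrite ?mulr0.
Qed.

Lemma bipolyP a D (P : {poly {poly K}}) : (size P <= a.+1)%N -> (sizeY P <= D.+1)%N ->
  P = bipoly (fun z : 'I_a.+1 * 'I_D.+1 => P`_z.1`_z.2).
Proof.
move=> sP sYP; apply/polyP => i; apply/polyP => j; rewrite coef_bipoly /=.
case: ltnP => [ia|ia] /=; last first.
  have -> : P`_i = 0 by rewrite nth_default // (leq_trans sP).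
  by rewrite coef0.
case: ltnP => [jD|jD]; first by rewrite !inordK.
by rewrite nth_default // (leq_trans (max_size_coefXY _ _)) // (leq_trans sYP).
Qed.

Lemma pf_bipoly T (c : set (T -> K)) a D (g : 'I_a.+1 * 'I_D.+1 -> T -> K) i j :
  (forall z, pfun c (g z)) -> pfun c (fun t => (bipoly (fun z => g z t))`_i`_j).
Proof.
move=> pg; pose z0 : 'I_a.+1 * 'I_D.+1 := (inord i, inord j).
have -> : (fun t => (bipoly (fun z => g z t))`_i`_j) =
    if (i < a.+1)%N && (j < D.+1)%N then g z0 else fun=> 0.
  by apply/funext => t; rewrite coef_bipoly; case: ifP.
by case: ifP => _; [exact: pg|exact: pf_const].
Qed.

Lemma pf_coef_mul T (c : set (T -> K)) (P Q : T -> {poly {poly K}}) i j :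
  (forall r s, pfun c (fun t => (P t)`_r`_s)) -> (forall r s, pfun c (fun t => (Q t)`_r`_s)) ->
  pfun c (fun t => (P t * Q t)`_i`_j).
Proof.
move=> pP pQ; have -> : (fun t => (P t * Q t)`_i`_j) = (fun t =>
    \sum_(r < i.+1) \sum_(s < j.+1) (P t)`_r`_s * (Q t)`_(i - r)`_(j - s)).
  by apply/funext => t; rewrite coefM coef_sum; apply: eq_bigr => r _; rewrite coefM.
by apply: pf_sum => r _; apply: pf_sum => s _; apply: pf_mul.
Qed.

(** The polynomial y ^ d + x is irreducible, being of degree 1 in x. *)
Lemma XnD_X_factor d (m h : {poly {poly K}}) (a : K) : a != 0 ->
  m * h = a%:P *: ('X^d + 'X%:P) -> size m = 1%N \/ size h = 1%N.
Proof.
move=> a0 E.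
have swapE : swapXY m * swapXY h = a%:P%:P * ('X + ('X^d)%:P).
  rewrite -rmorphM E -mul_polyC rmorphM rmorphD rmorphXn /= swapXY_X swapXY_polyC map_polyC.
  by rewrite swapXY_polyC map_polyX addrC -rmorphXn.
have s2 : size (swapXY m * swapXY h) = 2.
  by rewrite swapE mul_polyC size_scale ?polyC_eq0 // size_XaddC.
have n0 : swapXY m * swapXY h != 0 by rewrite -size_poly_gt0 s2.
have [m0 h0] : swapXY m != 0 /\ swapXY h != 0.
  by move: n0; rewrite mulf_eq0 negb_or => /andP[].
have lE : lead_coef (swapXY m) * lead_coef (swapXY h) = a%:P.
  by rewrite -lead_coefM swapE lead_coefM lead_coefC lead_coefXaddC mulr1.
have const (u v : {poly {poly K}}) : size (swapXY u) = 1%N ->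
    lead_coef (swapXY u) * lead_coef (swapXY v) = a%:P -> size u = 1%N.
  move=> su /(polyC_mul a0) [b b0 lu].
  have uE : swapXY u = b%:P%:P.
    by rewrite (size1_polyC (eq_leq su)) -lu lead_coefE su.
  have -> : u = b%:P%:P by rewrite -[LHS]swapXYK uE swapXY_polyC map_polyC.
  by rewrite size_polyC polyC_eq0 b0.
move: s2; rewrite size_mul //.
have : (0 < size (swapXY m))%N by rewrite size_poly_gt0.
have : (0 < size (swapXY h))%N by rewrite size_poly_gt0.
case sm: (size (swapXY m)) => [|[|sm']] //; first by left; apply: (const m h).
case sh: (size (swapXY h)) => [|[|sh']] //.
  by right; apply: (const h m) => //; rewrite mulrC.
by rewrite addSn addnS /= addnS.
Qed.

End BoundedBivariate.

(** * A very general form is generic *)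

Section GenericSurface.
Context (K : numClosedFieldType) (d : nat) (d_gt1 : (1 < d)%N).
Implicit Types i j k l : 'I_4.
Notation V := (dhomog 4 K d).
Notation lin := (@lin_fun K V).

Let d_gt0 : (0 < d)%N. Proof. exact: ltnW. Qed.

Let dhomog_lin a (u v : V) : (a *: u + v : V) = a *: (u : {mpoly K[4]}) + v :> {mpoly K[4]}.
Proof. by []. Qed.

Let dhomogZ a (u : V) : (a *: u : V) = a *: (u : {mpoly K[4]}) :> {mpoly K[4]}.
Proof. by []. Qed.

Let dhomog_0 : (0 : V) = 0 :> {mpoly K[4]}.
Proof. by []. Qed.

Lemma pf_dhomog_eval x : pfun lin (fun F : V => (F : {mpoly K[4]}).@[x]).
Proof. by apply: pf_gen => a u v; rewrite dhomog_lin mevalD mevalZ. Qed.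

Lemma pf_coef_edge_poly k l m : pfun lin (fun F : V => (edge_poly F k l)`_m).
Proof.
apply: pf_gen => a u v; rewrite dhomog_lin /edge_poly mmapD mmapZ coefD.
by rewrite /= coefCM.
Qed.

Lemma pf_coef_face_poly j k l r s : pfun lin (fun F : V => (face_poly F j k l)`_r`_s).
Proof.
apply: pf_gen => a u v; rewrite dhomog_lin /face_poly mmapD mmapZ !coefD.
by rewrite /= !coefCM.
Qed.

Let edge_polyZ k l a (F : V) : edge_poly (a *: F : V) k l = a *: edge_poly F k l.
Proof. by rewrite /edge_poly dhomogZ mmapZ /= mul_polyC. Qed.

Let face_polyZ j k l a (F : V) : face_poly (a *: F : V) j k l = a%:P *: face_poly F j k l.
Proof. by rewrite /face_poly dhomogZ mmapZ /= mul_polyC. Qed.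

Let homogX i e : 'X_i ^+ e \is [in K[4], e.-homog].
Proof. by have := @dhomogMn 4 K mdeg 1 'X_i e; rewrite mul1n dhomogX /= mdeg1; apply. Qed.

Let mmapXU (A : comNzRingType) (f : {rmorphism K -> A}) h i :
  mmap f h ('X_i : {mpoly K[4]}) = h i.
Proof. by rewrite mmapX mmap1U. Qed.

Lemma very_general_vertex i : very_general (fun w : linsys K d =>
  forall F : V, represents F w -> ~ (F : {mpoly K[4]}).@[unitvec K i] = 0).
Proof.
pose F0 : V := DHomog (homogX i d).
have F0i : (F0 : {mpoly K[4]}).@[unitvec K i] = 1.
  by rewrite /= rmorphXn /= mevalXU /unitvec eqxx expr1n.
apply: (@very_general_alg _ _ [set F : V | (F : {mpoly K[4]}).@[unitvec K i] = 0] F0).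
- by apply: alg_zero; exact: pf_dhomog_eval.
- move=> a v a0 /= Fv; have /eqP : a * (v : {mpoly K[4]}).@[unitvec K i] = 0.
    by rewrite -mevalZ; exact: Fv.
  by rewrite mulf_eq0 (negPf a0) => /eqP.
- by apply/eqP => F00; move: F0i; rewrite F00 dhomog_0 meval0 => /esym/eqP; rewrite oner_eq0.
- by rewrite /= F0i => /eqP; rewrite oner_eq0.
Qed.

Lemma very_general_edge_subleading k l : k != l -> very_general (fun w : linsys K d =>
  forall F : V, represents F w -> ~ (edge_poly F k l)`_d.-1 = 0).
Proof.
move=> kl.
have hF0 : 'X_k ^+ d.-1 * 'X_l \is [in K[4], d.-homog].
  have := dhomogM (homogX k d.-1) (homogX l 1); rewrite expr1 addn1 prednK //; apply.
pose F0 : V := DHomog hF0.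
have F01 : (edge_poly F0 k l)`_d.-1 = 1.
  rewrite /edge_poly /= rmorphM rmorphXn /= !mmapXU /subst_var eqxx eq_sym (negPf kl) eqxx.
  by rewrite mulr1 coefXn eqxx.
apply: (@very_general_alg _ _ [set F : V | (edge_poly F k l)`_d.-1 = 0] F0).
- by apply: alg_zero; exact: pf_coef_edge_poly.
- move=> a v a0 /= Fv; have /eqP : a * (edge_poly v k l)`_d.-1 = 0.
    by rewrite -coefZ -edge_polyZ; exact: Fv.
  by rewrite mulf_eq0 (negPf a0) => /eqP.
- apply/eqP => F00; move: F01; rewrite F00 /edge_poly dhomog_0 rmorph0 coef0 => /esym/eqP.
  by rewrite oner_eq0.
- by rewrite /= F01 => /eqP; rewrite oner_eq0.
Qed.

(** F restricted to the edge has a multiple root at the point with homogeneous coordinates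
    (z.1 true : z.1 false). *)
Definition edge_double_root k l (z : (bool -> K) * V) : Prop :=
  homogenize (edge_poly z.2 k l) d (z.1 true) (z.1 false) = 0 /\
  homogenize (edge_poly z.2 k l)^`() d.-1 (z.1 true) (z.1 false) = 0.

Lemma very_general_edge_separable k l : k != l -> very_general (fun w : linsys K d =>
  forall F : V, represents F w ->
    ~ exists x, (exists b, x b != 0) /\ edge_double_root k l (x, F)).
Proof.
move=> kl.
have hF0 : 'X_k ^+ d + 'X_l ^+ d \is [in K[4], d.-homog] by rewrite rpredD.
pose F0 : V := DHomog hF0.
have F0E : edge_poly F0 k l = 'X^d + 1.
  rewrite /edge_poly /= rmorphD !rmorphXn /= !mmapXU /subst_var eqxx eq_sym (negPf kl) eqxx.
  by rewrite expr1n.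
have d0 : (0%N == d) = false by rewrite eq_sym eqn0Ngt d_gt0.
have pz b : pfun (prod_fun (@coord_fun K bool) lin) (fun z => z.1 b).
  by apply: pf_gen; left; exists (fun x => x b) => //; exists b.
have pe m : pfun (prod_fun (@coord_fun K bool) lin) (fun z => (edge_poly z.2 k l)`_m).
  exact: (@pf_snd _ _ lin _ (@coord_fun K bool) (fun F : V => (edge_poly F k l)`_m) (pf_coef_edge_poly k l m)).
apply: (@very_general_alg _ _
  [set F : V | exists x, (exists b, x b != 0) /\ edge_double_root k l (x, F)] F0).
- apply: elim_fin => [|a x F [/= e1 e2]]; last by split; rewrite /= homogenizeZ ?e1 ?e2 mulr0.
  apply: algI; apply: alg_zero; apply: pf_sum => m _; apply: pf_mul; rewrite /=.
  + exact: pe.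
  + by apply: pf_mul; apply: pf_exp; exact: pz.
  + under eq_fun do rewrite coef_deriv -mulr_natr.
    by apply: pf_mul; [exact: pe|exact: pf_const].
  + by apply: pf_mul; apply: pf_exp; exact: pz.
- move=> a F a0 [x [x0 [/= e1 e2]]]; exists x; split=> //; split=> /=.
    have /eqP : a * homogenize (edge_poly F k l) d (x true) (x false) = 0.
      by rewrite -homogenize_scale -edge_polyZ; exact: e1.
    by rewrite mulf_eq0 (negPf a0) => /eqP.
  have /eqP : a * homogenize (edge_poly F k l)^`() d.-1 (x true) (x false) = 0.
    by rewrite -homogenize_scale -derivZ -edge_polyZ; exact: e2.
  by rewrite mulf_eq0 (negPf a0) => /eqP.
- apply/eqP => F00; move: (congr1 (fun p : {poly K} => p`_0) F0E).
  rewrite F00 /edge_poly dhomog_0 rmorph0 coef0 coefD coefXn coef1 eqxx.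
  by rewrite d0 add0r => /esym/eqP; rewrite oner_eq0.
case=> x [x0 []]; rewrite /= F0E => e1 e2.
have deriv_F0 m : ('X^d + 1 : {poly K})^`()`_m = (m == d.-1)%:R *+ d.
  by rewrite derivD derivXn -[1]/(1%:P) derivC addr0 coefMn coefXn.
have e2' : d%:R * x true ^+ d.-1 = 0.
  rewrite -e2 /homogenize (bigD1 ord_max) //= big1 => [|m mm].
    by rewrite deriv_F0 eqxx subnn expr0 mulr1 addr0.
  rewrite deriv_F0.
  by rewrite (_ : (m == d.-1 :> nat) = false) ?mul0rn ?mul0r //; apply/negbTE.
have xt : x true = 0.
  move/eqP: e2'; rewrite mulf_eq0 Num.Theory.pnatr_eq0 eqn0Ngt d_gt0 expf_eq0 /= => /andP[_ /eqP //].
have xf : x false = 0.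
  move/eqP: e1; rewrite xt /homogenize big_ord_recl big1 /= => [|m _].
    rewrite coefD coefXn coef1 eqxx d0 add0r mul1r expr0 mul1r subn0 addr0.
    by rewrite expf_eq0 d_gt0 => /eqP.
  by rewrite expr0n mul0r mulr0.
by case: x0 => -[]; rewrite ?xt ?xf eqxx.
Qed.

(** The restriction of F to a face and the product of the two factors z.1 and z.2.1 are
    proportional: their 2 x 2 minors vanish. *)
Definition face_factors j k l a b
    (z : ('I_a.+1 * 'I_d.+1 -> K) * (('I_b.+1 * 'I_d.+1 -> K) * V)) : Prop :=
  forall p q r s, (face_poly z.2.2 j k l)`_p`_q * (bipoly z.1 * bipoly z.2.1)`_r`_s =
    (face_poly z.2.2 j k l)`_r`_s * (bipoly z.1 * bipoly z.2.1)`_p`_q.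

Definition face_reducible j k l a b (F : V) : Prop :=
  exists h, (exists z, h z != 0) /\
    exists m, (exists z, m z != 0) /\ @face_factors j k l a b (m, (h, F)).

Lemma alg_face_reducible j k l a b : alg lin [set F : V | face_reducible j k l a b F].
Proof.
pose c1 := prod_fun (@coord_fun K ('I_b.+1 * 'I_d.+1)) lin.
pose c2 := prod_fun (@coord_fun K ('I_a.+1 * 'I_d.+1)) c1.
have pm p q : pfun c2 (fun z => (bipoly z.1)`_p`_q).
  apply: (@pf_bipoly K _ c2 a d (fun u z => z.1 u) p q) => u.
  by apply: pf_gen; left; exists (fun x => x u) => //; exists u.
have ph p q : pfun c2 (fun z => (bipoly z.2.1)`_p`_q).
  apply: (@pf_bipoly K _ c2 b d (fun u z => z.2.1 u) p q) => u.
  apply: pf_gen; right; exists (fun z => z.1 u) => //.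
  by left; exists (fun x => x u) => //; exists u.
have pF p q : pfun c2 (fun z => (face_poly z.2.2 j k l)`_p`_q).
  apply: (@pf_snd _ _ c1 _ _ (fun z => (face_poly z.2 j k l)`_p`_q)).
  apply: (@pf_snd _ _ lin _ _ (fun F : V => (face_poly F j k l)`_p`_q)).
  exact: pf_coef_face_poly.
have pmh p q : pfun c2 (fun z => (bipoly z.1 * bipoly z.2.1)`_p`_q).
  exact: pf_coef_mul.
have aZ : alg c2 [set z | @face_factors j k l a b z].
  by do 4![apply: alg_bigI => ?]; apply: alg_eq; apply: pf_mul.
have a1 : alg c1 [set t | exists m, (exists z, m z != 0) /\ @face_factors j k l a b (m, t)].
  apply: (elim_fin aZ) => t m [h F] ff p q r s; rewrite /= bipolyZ -scalerAl !coefZ !coefCM.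
  by rewrite mulrCA [RHS]mulrCA ff.
apply: (elim_fin a1) => t h F [m [m0 ff]]; exists m; split=> // p q r s.
rewrite /= bipolyZ -scalerAr !coefZ !coefCM.
by rewrite mulrCA [RHS]mulrCA ff.
Qed.

Lemma very_general_face j k l a : uniq [:: j; k; l] -> (0 < a < d)%N ->
  very_general (fun w : linsys K d =>
    forall F : V, represents F w -> ~ face_reducible j k l a (d - a) F).
Proof.
move=> /= /and3P[]; rewrite !inE negb_or => /andP[jk jl] kl _ /andP[a0 ad].
have hF0 : 'X_j ^+ d + 'X_k * 'X_l ^+ d.-1 \is [in K[4], d.-homog].
  rewrite rpredD //; have := dhomogM (homogX k 1) (homogX l d.-1).
  by rewrite expr1 add1n prednK //; apply.
pose F0 : V := DHomog hF0.
have F0E : face_poly F0 j k l = 'X^d + 'X%:P.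
  rewrite /face_poly /= rmorphD rmorphM !rmorphXn /= !mmapXU /subst_var eqxx.
  rewrite ![_ == j]eq_sym (negPf jk) (negPf jl) eqxx [l == k]eq_sym (negPf kl) eqxx.
  by rewrite expr1n mulr1.
have d0 : (d == 0%N) = false by rewrite eqn0Ngt d_gt0.
have F0d : (face_poly F0 j k l)`_d`_0 = 1.
  by rewrite F0E coefD coefXn eqxx coefC d0 addr0 coef1.
apply: (@very_general_alg _ _ [set F : V | face_reducible j k l a (d - a) F] F0).
- exact: alg_face_reducible.
- move=> t F t0 [h [h0 [m [m0 ff]]]].
  exists h; split; [exact: h0|exists m; split; [exact: m0|move=> p q r s /=]].
  have : (t%:P *: face_poly F j k l)`_p`_q * (bipoly m * bipoly h)`_r`_s =
         (t%:P *: face_poly F j k l)`_r`_s * (bipoly m * bipoly h)`_p`_q.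
    rewrite -face_polyZ; exact: ff.
  rewrite !coefZ !coefCM -!mulrA.
  exact: mulfI.
- apply/eqP => F00; move: F0d; rewrite F00 /face_poly dhomog_0 rmorph0 !coef0 => /esym/eqP.
  by rewrite oner_eq0.
case=> h [h0 [m [m0 ff]]].
have mn0 : bipoly m != 0.
  by apply/eqP => /bipoly_eq0 e; case: m0 => z; rewrite e eqxx.
have hn0 : bipoly h != 0.
  by apply/eqP => /bipoly_eq0 e; case: h0 => z; rewrite e eqxx.
pose c := (bipoly m * bipoly h)`_d`_0.
have E : bipoly m * bipoly h = c%:P *: ('X^d + 'X%:P).
  apply/polyP => r; apply/polyP => s; have := ff d 0%N r s.
  by rewrite /= F0d mul1r F0E coefZ coefCM [RHS]mulrC.
have c0 : c != 0.
  apply: contraTneq (mulf_neq0 mn0 hn0) => c0.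
  by rewrite E c0 scale0r eqxx.
have sE : size (bipoly m * bipoly h) = d.+1.
  rewrite E size_scale ?polyC_eq0 // size_polyDl size_polyXn // size_polyC polyX_eq0.
  by rewrite ltnS d_gt0.
have sm := size_bipoly m; have sh := size_bipoly h.
move: sE; rewrite size_mul //; have [->|->] := XnD_X_factor c0 E.
  rewrite add1n /= => sE; move: sh; rewrite sE ltnS leqNgt ltn_subrL a0 d_gt0 //.
rewrite addn1 /= => sE; move: sm; rewrite sE ltnS leqNgt ad //.
Qed.

(** A factorization of the face polynomial has factors of complementary degrees, which
    are bounded in the inner variable as well. *)
Lemma generic_formP (F : V) :
  (forall i, (F : {mpoly K[4]}).@[unitvec K i] <> 0) ->
  (forall k l, k != l -> (edge_poly F k l)`_d.-1 <> 0) ->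
  (forall k l, k != l -> ~ exists x, (exists b, x b != 0) /\ edge_double_root k l (x, F)) ->
  (forall j k l a, uniq [:: j; k; l] -> (0 < a < d)%N -> ~ face_reducible j k l a (d - a) F) ->
  generic_form F.
Proof.
move=> vF eF sF fF i j k l u.
have hF : (F : {mpoly K[4]}) \is d.-homog := dhomog_is_dhomog F.
split; first by apply/eqP; exact: vF.
- have u' : uniq [:: j; k; l] by move: u; rewrite cons_uniq => /andP[].
  have jk : j != k by move: u'; rewrite /= !inE negb_or => /andP[/andP[]].
  move=> m h fE; set f := face_poly F j k l in fE.
  have sf : size f = d.+1.
    apply/eqP; rewrite eqn_leq size_face_poly //= ltnNge; apply/negP => s.
    by have /eqP := coef_face_poly hF j k l; rewrite nth_default // eq_sym polyC_eq0 => /eqP/vF.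
  have fn0 : f != 0 by rewrite -size_poly_gt0 sf.
  have [mn0 hn0] : m != 0 /\ h != 0.
    by move: fn0; rewrite fE mulf_eq0 negb_or => /andP[].
  have [sm|sm] := leqP (size m) 1; first by left.
  have [sh|sh] := leqP (size h) 1; first by right.
  exfalso; pose a := (size m).-1.
  have smE : size m = a.+1 by rewrite /a prednK // ltnW.
  have shE : size h = (d - a).+1.
    have : d.+1 = (a.+1 + size h).-1 by rewrite -sf fE size_mul // smE.
    rewrite addSn /= => e; apply: (@addnI a); rewrite -e addnS subnKC // -ltnS e.
    by rewrite -[X in (X < _)%N]addn0 ltn_add2l (ltn_trans _ sh).
  have sYf : (sizeY f <= d.+1)%N.
    by rewrite sizeYE /f swapXY_face_poly // size_face_poly.
  have sYm : (sizeY m <= d.+1)%N /\ (sizeY h <= d.+1)%N.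
    have bound (x y z : nat) : (0 < x)%N -> (0 < y)%N -> ((x + y).-1 <= z)%N ->
        (x <= z)%N /\ (y <= z)%N by lia.
    rewrite !sizeYE; apply: bound; rewrite ?size_poly_gt0 ?swapXY_eq0 //.
    by rewrite -size_mul ?swapXY_eq0 // -rmorphM -sizeYE -fE.
  apply: (fF j k l a u').
    by apply/andP; split; [rewrite -ltnS -smE|rewrite -subn_gt0 -ltnS -shE].
  have nonzero b (P : {poly {poly K}}) : P != 0 -> (size P <= b.+1)%N -> (sizeY P <= d.+1)%N ->
      exists z : 'I_b.+1 * 'I_d.+1, P`_z.1`_z.2 != 0.
    move=> P0 sP sYP; apply: contrapT => /forallNP z0; move/eqP: P0; apply.
    rewrite (bipolyP sP sYP); apply/polyP => r; apply/polyP => s.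
    by rewrite coef_bipoly !coef0; case: ifP => // _; apply/eqP/negPn/negP/z0.
  have [sYm1 sYh1] := sYm.
  exists (fun z : 'I_(d - a).+1 * 'I_d.+1 => h`_z.1`_z.2).
  split; first by apply: nonzero; rewrite ?shE.
  exists (fun z : 'I_a.+1 * 'I_d.+1 => m`_z.1`_z.2).
  split; first by apply: nonzero; rewrite ?smE.
  move=> p q r s /=; rewrite -(@bipolyP K a d m) ?smE // -(@bipolyP K (d - a) d h) ?shE //.
  by rewrite -fE mulrC.
have kl : k != l by move: u; rewrite /= !inE => /and4P[_ _ ? _].
have lk : l != k by rewrite eq_sym.
set n := edge_poly F k l; rewrite (_ : [set r | _] = [set r | n.[r] = 0]); last first.
  by apply/seteqP; split=> r /=; rewrite horner_edge_poly.
have sn : (size n <= d.+1)%N by exact: size_edge_poly.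
apply: (asymmetric_roots d_gt1) => //.
- by rewrite coef_edge_poly //; apply/eqP; exact: vF.
- by apply/eqP; exact: eF.
- rewrite horner_edge_poly (_ : F.@[_] = F.@[unitvec K l]); first by apply/eqP; exact: vF.
  apply: meval_eq => t; rewrite /pt2 /unitvec; have [->|tk] := eqVneq t k.
    by rewrite (negPf kl).
  by case: eqP.
move=> r nr; apply/eqP => n'r; apply: (sF k l kl).
exists (fun b => if b then r else 1); split; first by exists false; exact: oner_neq0.
split=> /=; first by rewrite homogenize_horner.
rewrite homogenize_horner // prednK //; apply: leq_trans (size_poly _ _) _.
by case: (size n) sn.
Qed.

Lemma very_general_generic_form : very_general (fun w : linsys K d =>
  forall F : V, represents F w -> generic_form F).
Proof.
pose i0 : 'I_4 := ord0.
pose F0 : V := DHomog (homogX i0 d).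
have F00 : F0 != 0.
  apply/eqP => /(congr1 (fun F : V => (F : {mpoly K[4]}).@[unitvec K i0])).
  rewrite dhomog_0 meval0 /= rmorphXn /= mevalXU /unitvec eqxx expr1n => /eqP.
  by rewrite oner_eq0.
have dF0 : \dim <[F0]>%VS == 1%N by rewrite dim_vline F00.
pose x0 : linsys K d := exist _ <[F0]>%VS dF0.
have g1 := very_general_all x0 very_general_vertex.
have g2 := very_general_all x0 (fun z : 'I_4 * 'I_4 =>
  very_general_imp x0 (fun kl : z.1 != z.2 => very_general_edge_subleading kl)).
have g3 := very_general_all x0 (fun z : 'I_4 * 'I_4 =>
  very_general_imp x0 (fun kl : z.1 != z.2 => very_general_edge_separable kl)).
have g4 := very_general_all x0 (fun z : 'I_4 * 'I_4 * 'I_4 * nat =>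
  very_general_imp x0 (fun u : uniq [:: z.1.1.1; z.1.1.2; z.1.2] =>
  very_general_imp x0 (fun ad : (0 < z.2 < d)%N => very_general_face u ad))).
have [B [hB BQ]] := very_general_and x0 (very_general_and x0 g1 g2) (very_general_and x0 g3 g4).
exists B; split=> // w /BQ [[h1 h2] [h3 h4]] F rF; apply: generic_formP.
- by move=> i; exact: (h1 i F rF).
- by move=> k l kl; exact: (h2 (k, l) kl F rF).
- by move=> k l kl; exact: (h3 (k, l) kl F rF).
- by move=> j k l a u ad; exact: (h4 (j, k, l, a) u ad F rF).
Qed.

End GenericSurface.

(** * From projective curves to cones *)

Section Bridge.
Context (K : closedFieldType).
Implicit Types (X Y : set (P3 K)) (x p q : 'I_4 -> K).

Definition row_of x : 'rV[K]_4 := \row_i x i.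

Lemma row_ofE x : row_of x 0 = x.
Proof. by apply/funext => i; rewrite mxE. Qed.

Lemma row_of0 (v : 'rV[K]_4) : row_of (v 0) = v.
Proof. by apply/rowP => i; rewrite mxE. Qed.

Lemma row_of_neq0 x : row_of x != 0 <-> exists i, x i != 0.
Proof.
split=> [v0|[i xi]]; last first.
  by apply: (introT (rV0Pn _)); exists i; rewrite mxE.
by have [i vi] := elimT (rV0Pn _) v0; exists i; rewrite mxE in vi.
Qed.

Lemma point_of (V : vectType K) (v : V) : v != 0 -> exists P : projspace V, represents v P.
Proof.
move=> v0; have dv : \dim <[v]>%VS == 1%N by rewrite dim_vline v0.
by exists (exist _ <[v]>%VS dv).
Qed.

(** The vectors of homogeneous coordinates of the points of X. *)
Definition cone X : set ('I_4 -> K) := [set x | exists2 P, X P & represents (row_of x) P].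

Lemma homog_eval_point e (f : {mpoly K[4]}) (P : P3 K) v w : f \is e.-homog ->
  represents v P -> represents w P -> f.@[v 0] = 0 -> f.@[w 0] = 0.
Proof.
move=> hf rv rw fv; have [c _ ->] := represents_scale rv rw.
rewrite -(homog_eval0 c hf fv); apply: meval_eq => i; by rewrite mxE.
Qed.

Definition zero_locus (f : {mpoly K[4]}) : set (P3 K) :=
  [set P | forall v : 'rV[K]_4, represents v P -> f.@[v 0] = 0].

Lemma closed_zero_locus e f : f \is e.-homog -> closed (zero_locus f).
Proof.
move=> hf; apply/projspace_closedE; exists [set f] => [_ ->|]; first by exists e.
apply/seteqP; split=> P fP; first by move=> _ ->; exact: fP.
exact: (fP f erefl).
Qed.

Lemma hcurve_cone X : curve X -> hcurve (cone X).
Proof.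
case=> /projspace_closedE [S hS XE] [_ irr] [[Z [hZ ltZ]] _]; split.
- exists S => // x; split=> [[P XP rx]|[x0 Sx]].
    split; first exact/row_of_neq0/(represents_neq0 rx).
    by move=> f Sf; rewrite -(row_ofE x); move: XP; rewrite XE => /(_ f Sf); apply.
  have /row_of_neq0/point_of [P rx] := x0; exists P => //; rewrite XE => f Sf v rv.
  have [e hf] := hS f Sf; apply: (homog_eval_point hf rx rv).
  by rewrite row_ofE; exact: Sx.
- move=> e f e' g hf hg fg.
  have [P XP|XF|XG] := irr _ _ (closed_zero_locus hf) (closed_zero_locus hg).
  + have [v rv] := represents_ex P.
    have [|fv|gv] := fg (v 0); first by exists P => //; rewrite row_of0.
      by left=> w rw; exact: (homog_eval_point hf rv rw).
    by right=> w rw; exact: (homog_eval_point hg rv rw).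
  + by left=> x [P /XF + rx] => /(_ _ rx); rewrite row_ofE.
  + by right=> x [P /XG + rx] => /(_ _ rx); rewrite row_ofE.
case=> c cX; have [_ [[P0 Z0P0] _] Z0X] := hZ 0%N isT.
have [_ /existsNP [P1 /not_implyP [Z1P1 Z0P1]]] := ltZ 0%N isT.
have [_ _ Z1X] := hZ 1%N isT.
apply: Z0P1; suff -> : P1 = P0 by [].
have par P : X P -> exists2 s, s != 0 & represents (s *: row_of c) P.
  move=> XP; have [v rv] := represents_ex P.
  have [|s vE] := cX (v 0); first by exists P => //; rewrite row_of0.
  have vE' : v = s *: row_of c by apply/rowP => i; rewrite vE !mxE.
  exists s; last by rewrite -vE'.
  by apply: contraNneq (represents_neq0 rv) => s0; rewrite vE' s0 scale0r.
have [s s0 r0] := par _ (Z0X _ Z0P0); have [t t0 r1] := par _ (Z1X _ Z1P1).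
apply: val_inj; rewrite -r0 -r1.
have vline (a : K) : a != 0 -> <[a *: row_of c]>%VS = <[row_of c]>%VS.
  move=> a0; apply: subv_anti; rewrite -!memvE rpredZ ?memv_line //=.
  by rewrite -[X in X \in _](scalerK a0) rpredZ // memv_line.
by rewrite !vline.
Qed.

Lemma notin_ord4 (s : seq 'I_4) : (size s < 4)%N -> exists i, i \notin s.
Proof.
move=> s4; apply: contrapT => /forallNP sP; move: s4; rewrite ltnNge => /negP; apply.
rewrite -[X in (X <= _)%N](card_ord 4) (leq_trans _ (card_size s)) //.
apply/subset_leq_card/fintype.subsetP => i _.
by apply/negPn/negP/sP.
Qed.

(** The products lie on W by definition; since W is the closure of their set, a plane
    containing all of them contains W, and a plane x_i = a x_j cannot contain the two
    or more points of W on the edge (x_i : x_j). *)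
Lemma surface_generic_form d (w : linsys K d) (F : dhomog 4 K d) X Y :
  (0 < d)%N -> represents F w -> generic_form F -> curve X -> curve Y ->
  surface w = hadamard X Y -> hadamard_pair F (cone X) (cone Y).
Proof.
move=> d0 rF gF cX cY WE; have hF : (F : {mpoly K[4]}) \is d.-homog := dhomog_is_dhomog F.
have FW (P : P3 K) (v : 'rV[K]_4) : represents v P -> (F : {mpoly K[4]}).@[v 0] = 0 -> surface w P.
  move=> rv Fv F' rF' v' rv'; have [c _ ->] := represents_scale rF rF'.
  change ((c *: (F : {mpoly K[4]})).@[v' 0] = 0).
  by rewrite mevalZ (homog_eval_point hF rv rv') ?mulr0.
have prod p q : cone X p -> cone Y q -> row_of (pmul p q) != 0 ->
    exists2 P, hadamard_points X Y P & represents (row_of (pmul p q)) P.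
  move=> [P XP rp] [Q YQ rq] /point_of [T rT]; exists T => //.
  exists P, Q; split=> //; exists (row_of p), (row_of q); split=> //.
  rewrite (_ : map2_mx _ _ _ = row_of (pmul p q)) //.
  by apply/rowP => i; rewrite !mxE.
split; [exact: hcurve_cone|exact: hcurve_cone| |].
- move=> p q Xp Yq; have [pq0|/(prod p q Xp Yq) [P hP rP]] := eqVneq (row_of (pmul p q)) 0.
    rewrite -(row_ofE (pmul p q)) pq0 (_ : (0 : 'rV_4) 0 = fun i => 0 * unitvec K ord0 i).
      by rewrite (mevalZ_homog _ _ hF) expr0n eqn0Ngt d0 mul0r.
    by apply/funext => i; rewrite mxE mul0r.
  have : surface w P by rewrite WE; exact: subset_closure.
  by move=> /(_ F rF _ rP); rewrite row_ofE.
move=> i j a ij pq.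
have hg := homog1_ratio i j a.
have WC : surface w `<=` zero_locus ('X_i - a *: 'X_j).
  have /closure_id -> := closed_zero_locus hg.
  rewrite WE; apply: closure_subset => R [P [Q [XP YQ [p [q [rp rq rR]]]]]].
  move=> v /(represents_scale rR) [c _ ->].
  rewrite mevalB mevalZ !mevalXU !mxE.
  have := pq (p 0) (q 0); rewrite /pmul => ->; first by rewrite mulrCA subrr.
    by exists P => //; rewrite row_of0.
  by exists Q => //; rewrite row_of0.
have [k] : exists k, k \notin [:: i; j] by exact: notin_ord4.
have [l] : exists l, l \notin [:: k; i; j] by exact: notin_ord4.
rewrite !inE !negb_or => /and3P[lk li lj] /andP[ki kj].
have u : uniq [:: l; k; i; j].
  by rewrite /= !inE !negb_or lk li lj ki kj ij.
have [_ _ [[r [s [/= Fr Fs rs]]] _]] := gF l k i j u.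
have root_a t : (F : {mpoly K[4]}).@[pt2 i j t 1] = 0 -> t = a.
  move=> Ft; have : row_of (pt2 i j t 1) != 0.
    by apply/row_of_neq0; exists j; rewrite /pt2 [j == i]eq_sym (negPf ij) eqxx oner_eq0.
  move=> /point_of [P rP]; have /WC/(_ _ rP) : surface w P.
    by apply: FW rP _; rewrite row_ofE.
  rewrite row_ofE mevalB mevalZ !mevalXU /pt2 eqxx [j == i]eq_sym (negPf ij) eqxx mulr1.
  by move/eqP; rewrite subr_eq0 => /eqP.
by move: rs; rewrite (root_a _ Fr) (root_a _ Fs) eqxx.
Qed.

End Bridge.

Theorem theorem1p3 (R : realType) (d : nat) (hd : (4 <= d)%N) :
  very_general (fun w : linsys (complex R) d =>
    ~ exists X Y : set (P3 (complex R)),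
        [/\ curve X, curve Y, hadamard_defined X Y & surface w = hadamard X Y]).
Proof.
have d1 : (1 < d)%N by exact: leq_trans hd.
have [B [hB gB]] := @very_general_generic_form (complex R) d d1.
exists B; split=> // w /gB gw [X [Y [cX cY _ WE]]].
have [F rF] := represents_ex w.
have hF : (F : {mpoly (complex R)[4]}) \is d.-homog := dhomog_is_dhomog F.
apply: (generic_no_hadamard_pair hF (gw F rF)).
exact: (surface_generic_form (ltnW d1) rF (gw F rF) cX cY WE).
Qed.
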